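(* Let $\mathrm{OPT}$ be the optimal value of the linear program (P) defined in the context (with no assumption that its time horizon is polynomially bounded in $m$). For any $\epsilon>0$, the modified Algorithm 1 (described in full in the context), run on an optimal solution $(x',y',z')$ of the restricted program $(\mathrm P)_{\mathrm{TS}}$, succeeds with high probability (failure probability at most $1/\mathrm{poly}(m)$) and returns a solution to the MLUFL instance of expected cost (conditioned on success) $$O\bigl(\log n\max\{\log n,\log m\}\bigr)(1+\epsilon)\,\mathrm{OPT}.$$
   Context: **MLUFL** (minimum-latency uncapacitated facility location). The input is a set $\mathcal F$ of $n$ facilities with opening costs $f_i$, a set $\mathcal D$ of $m$ clients, connection costs $c_{ij}$ for $i\in\mathcal F$, $j\in\mathcal D$ (not necessarily a metric), a root $r$, and an integer-valued metric $d$ on $\mathcal F\cup\{r\}$ (the time metric). A feasible solution is a set $F\subseteq\mathcal F$ of open facilities, a path $P$ starting at $r$ and spanning $F$, and an assignment $\phi:\mathcal D\to F$. Its cost is $\sum_{i\in F}f_i+\sum_{j\in\mathcal D}(c_{\phi(j)j}+t_j)$, where $t_j=d_P(r,\phi(j))$ is the time taken to reach $\phi(j)$ along $P$. **The LP (P).** Let $E$ be the edge set of the complete graph on $\mathcal F\cup\{r\}$, $d_{\max}=\max_{e\in E}d_e$, and let $T\le\min\{n,m\}d_{\max}$ be a known upper bound on the maximum activation time of an open facility in an optimal solution. For $S\subseteq\mathcal F$, $\delta(S)$ is the set of edges of $E$ with exactly one end in $S$. With $i\in\mathcal F$, $j\in\mathcal D$, $e\in E$, $t\in\{1,\dots,T\}$,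 (P) is: minimize $\sum_{i,t}f_iy_{i,t}+\sum_{j,i,t}(c_{ij}+t)x_{ij,t}$ subject to $\sum_{i,t}x_{ij,t}\ge1$ for all $j$; $x_{ij,t}\le y_{i,t}$ for all $i,j,t$; $\sum_ed_ez_{e,t}\le t$ for all $t$; $\sum_{e\in\delta(S)}z_{e,t}\ge\sum_{i\in S,\,t'\le t}x_{ij,t'}$ for all $t$, $S\subseteq\mathcal F$, $j$; $x,y,z\ge0$; and $y_{i,t}=0$ whenever $d_{ir}>t$. **The restricted LP.** Given $\epsilon>0$, let $T_q=\lceil(1+\epsilon)^q\rceil$ and $\mathrm{TS}=\{T_0,T_1,\dots,T_k\}$, where $k$ is the smallest integer with $T_k\ge\min\{n,m\}d_{\max}$. $(\mathrm P)_{\mathrm{TS}}$ denotes (P) with $t$ ranging over $\mathrm{TS}$. For $x\le T_k$, $\mathrm{TS}(x)$ is the earliest time in $\mathrm{TS}$ that is at least $x$; for $x\ge T_k$, $\mathrm{TS}(x):=T_k$. **Two known subroutines.** *Tree embedding*: given edge weights $\{w_e\}_{e\in E}$, one can deterministically construct a weighted tree $\mathcal T$ with leaf set $\mathcal F\cup\{r\}$ whose tree metric $d_{\mathcal T}$ satisfies $d_{\mathcal T}(i,i')\ge d_{ii'}$ for all $i,i'\in\mathcal F\cup\{r\}$ and $\sum_{(i,i')\in E}d_{\mathcal T}(i,i')w_{ii'}=O(\log n)\sum_ed_ew_e$. *GKR algorithm* (Garg–Konjevod–Ravi): given a tree $\mathcal T$ rooted at $r$ with $n$ leaves, groups $G_1,\dots,G_p$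 of leaves, and values $w_e$ on the edges of $\mathcal T$ such that $w(\delta(S))\ge\nu_j$ for every group $G_j$ and every node set $S\supseteq G_j$ with $r\notin S$, where $\nu_j\in[\frac12,1]$, this randomized polynomial-time algorithm returns a subtree $T''$ of $\mathcal T$ rooted at $r$ with $\Pr[e\in T'']\le w_e$ for every edge $e$ and $\Pr[T''\cap G_j=\emptyset]\le\exp\bigl(-\frac{\nu_j}{64\log_2n}\bigr)$ for every $j$. **Modified Algorithm 1.** Input: an optimal solution $(x',y',z')$ of $(\mathrm P)_{\mathrm{TS}}$; all times below range over $\mathrm{TS}$. For each client $j$ let $C^*_j=\sum_{i,t}c_{ij}x'_{ij,t}$, $L^*_j=\sum_{i,t}t\,x'_{ij,t}$, $N_j=\{i\in\mathcal F:c_{ij}\le4C^*_j\}$, and let $\tau_j$ be the earliest time $t$ with $\sum_{i\in N_j,\,t'\le t}x'_{ij,t'}\ge\frac23$. Let $\tau_{\max}=\max_j\tau_j$ and $\overline L=\bigl(\sum_jL^*_j\bigr)/m$. A1. For each phase $\ell=0,1,\dots,\mathcal N:=\lceil\log_2(2\tau_{\max}/\overline L)+4\log_2m\rceil$, let $t_\ell=\mathrm{TS}(\overline L\cdot2^\ell)$ and do the following. A1.1. Apply the tree embedding with edge weights $\{z'_{e,t_\ell}\}$ to get a tree $\mathcal T_\ell$ with edge set $E(\mathcal T_\ell)$. Extend it to a tree $\mathcal T'_\ell$ by adding, for each facility $i$, a dummy leaf edge $(i,v_i)$ of cost $f_i$. Let $E'=\{(i,v_i):i\in\mathcal F\}$.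 A1.2. Define $w$ on the edges of $\mathcal T'_\ell$: for $e\in E(\mathcal T_\ell)$, $w_e=\sum z'_{ii',t_\ell}$ over all pairs $(i,i')\in E$ such that $e$ lies on the unique $i$–$i'$ path in $\mathcal T_\ell$; for $e=(i,v_i)\in E'$, $w_e=\sum_{t\le t_\ell}y'_{i,t}$. A1.3. Let $D_\ell=\{j:\tau_j\le t_\ell\}$ and, for $j\in D_\ell$, define the group $N'_j=\{v_i:i\in N_j\}$. Obtain $N:=\log_2m$ subtrees $T''_1,\dots,T''_N$ of $\mathcal T'_\ell$, where each $T''_q$ is the union of the subtrees returned by $192\log_2n$ executions of the GKR algorithm on $\mathcal T'_\ell$ with values $w$ and groups $\{N'_j\}_{j\in D_\ell}$ (one may assume $i\in T''_q$ iff $(i,v_i)\in T''_q$). Let $T'_\ell$ be any of these trees satisfying both (i) $\sum_{(i,v_i)\in E(T'_\ell)}f_i\le40\cdot192\log_2n\sum_{(i,v_i)\in E'}f_iw_{(i,v_i)}$ and (ii) $\sum_{e\in E(T'_\ell)\setminus E'}d_{\mathcal T_\ell}(e)\le40\cdot192\log_2n\sum_{e\in E(\mathcal T_\ell)}d_{\mathcal T_\ell}(e)w_e$. If no such tree exists, the algorithm fails. A1.4. Remove all dummy edges from $T'_\ell$, open all the facilities in the resulting tree, and convert this tree into a tour $\mathrm{Tour}_\ell$ traversing all the opened facilities (double all edges, take an Eulerian tour, shortcut). Connect every not-yet-connected client $j$ to a facility in $N_j$ if some such facility is open (and hence part of $\mathrm{Tour}_\ell$). A2. Return the concatenation of the tours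 $\mathrm{Tour}_\ell$ for $\ell=0,1,\dots,\mathcal N$, shortcutting whenever possible; this induces an ordering of the open facilities. If some client is left unconnected, the algorithm has failed. The algorithm *succeeds* if it does not fail in A1.3 or A2.
   Formalization: In the number of phases the first logarithm is replaced by its nonnegative part; the O(.) constant is uniform only over bounded ε (0<ε≤ε0); ''any of these trees'' means a rule that sees only which trees satisfy (i) and (ii); n,m≥2. *)

(* Defs.v *)
From mathcomp Require Import all_boot all_order all_algebra.
From mathcomp Require classical_sets.
From mathcomp Require Import reals sequences exp.

Set Implicit Arguments.
Unset Strict Implicit.
Unset Printing Implicit Defensive.

Import Order.TTheory GRing.Theory Num.Theory.
Local Open Scope ring_scope.

Definition log2 (R : realType) (x : R) : R := ln x / ln 2.

(* Rounding up to nat (used on nonnegative reals only). *)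
Definition ceiln (R : realType) (x : R) : nat := `|Num.ceil x|%N.

Record graph := Graph { vertex :> finType; adj : rel vertex }.

(* An edge is the set of its two endpoints. *)
Definition edges (G : graph) : {set {set G}} :=
  [set [set p.1; p.2] | p : G * G & adj p.1 p.2].

Definition complete_graph (V : finType) : graph := Graph (fun u v : V => u != v).

(* delta(S): the edges with exactly one end in S *)
Definition cut (G : graph) (S : {set G}) : {set {set G}} :=
  [set e in edges G | #|e :&: S| == 1%N].

Definition degree (G : graph) (v : G) : nat := #|[set u | adj v u]|.

(* u :: p is a simple path from u to v *)
Definition simple_path (G : graph) (u v : G) (p : seq G) : bool :=
  [&& path (@adj G) u p, uniq (u :: p) & last u p == v].

Definition is_tree (G : graph) : Prop :=
  [/\ symmetric (@adj G), irreflexive (@adj G) &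
      forall u v : G, exists! p : seq G, simple_path u v p].

(* The edges traversed by the walk u :: p, with multiplicity. *)
Definition walk_edges (V : finType) (u : V) (p : seq V) : seq {set V} :=
  pairmap (fun a b => [set a; b]) u p.

(* The edges of the unique simple u-v path of a tree. *)
Definition tree_path_edges (G : graph) (u v : G) : seq {set G} :=
  walk_edges u (classical_sets.xget [::] (fun p => simple_path u v p)).

(* The leaves of a tree rooted at r; the root never counts as a leaf. *)
Definition rooted_leaves (G : graph) (r : G) : {set G} :=
  [set v | (v != r) && (degree v == 1%N)].

(* Subgraphs are given by their edge sets; the nodes of the subgraph A rooted
   at r are the nodes connected to r through A, so r always belongs to it. *)
Definition edge_rel (V : finType) (A : {set {set V}}) : rel V :=
  fun u v => [set u; v] \in A.

Definition subnodes (V : finType) (r : V) (A : {set {set V}}) : {set V} :=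
  [set v | connect (edge_rel A) r v].

Definition rooted_subtree (G : graph) (r : G) (A : {set {set G}}) : bool :=
  (A \subset edges G) && [forall e in A, e \subset subnodes r A].

(* u :: p is an Eulerian tour of the multigraph obtained from A by doubling
   every edge: a closed walk using each edge of A exactly twice. *)
Definition eulerian_tour_doubled (V : finType) (u : V) (A : {set {set V}})
    (p : seq V) : bool :=
  [&& path (edge_rel A) u p, last u p == u &
      [forall e in A, count_mem e (walk_edges u p) == 2%N]].

(* The node set F + {r}: facility i is Some i, the root r is None. *)
Definition node (n : nat) : finType := option 'I_n.

Definition is_metric (V : eqType) (d : V -> V -> nat) : Prop :=
  [/\ forall u v, (d u v == 0%N) = (u == v), forall u v, d u v = d v u &
      forall u v w, (d u w <= d u v + d v w)%N].

Record instance (R : realType) (n m : nat) := Instance {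
  fcost : 'I_n -> R;
  ccost : 'I_n -> 'I_m -> R;
  dist : node n -> node n -> nat;
  fcost_ge0 : forall i, 0 <= fcost i;
  ccost_ge0 : forall i j, 0 <= ccost i j;
  dist_metric : is_metric dist }.

Definition complete_edges (n : nat) : {set {set node n}} := edges (complete_graph (node n)).

(* The two ends of an edge of the complete graph, in unspecified order. *)
Definition ends (n : nat) (e : {set node n}) : node n * node n :=
  odflt (None, None) [pick p : node n * node n | (p.1 != p.2) && (e == [set p.1; p.2])].

Definition edge_dist (n : nat) (d : node n -> node n -> nat) (e : {set node n}) : nat :=
  d (ends e).1 (ends e).2.

Definition dmax (n : nat) (d : node n -> node n -> nat) : nat :=
  \max_(e in complete_edges n) edge_dist d e.

(* The path P is given by the order in which it visits the open facilities,
   the root being implicitly first. *)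
Record solution (n m : nat) := Solution {
  sopen : {set 'I_n};
  sroute : seq 'I_n;
  sassign : 'I_m -> 'I_n }.

Definition feasible (n m : nat) (s : solution n m) : Prop :=
  [/\ uniq (sroute s), sroute s =i sopen s & forall j, sassign s j \in sopen s].

Definition walk_length (V : Type) (d : V -> V -> nat) (u : V) (p : seq V) : nat :=
  sumn (pairmap d u p).

(* d_P(r, i) for i on the path *)
Definition arrival (n : nat) (d : node n -> node n -> nat) (route : seq 'I_n)
    (i : 'I_n) : nat :=
  walk_length d None (map some (take (index i route).+1 route)).

Definition cost (R : realType) (n m : nat) (I : instance R n m) (s : solution n m) : R :=
  \sum_(i in sopen s) fcost I i +
  \sum_j (ccost I (sassign s j) j + (arrival (dist I) (sroute s) (sassign s j))%:R).

Definition optimal_solution (R : realType) (n m : nat) (I : instance R n m)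
    (s : solution n m) : Prop :=
  feasible s /\ forall s', feasible s' -> cost I s <= cost I s'.

(* T is an upper bound on the activation times of the open facilities of some
   optimal solution. *)
Definition activation_bound (R : realType) (n m : nat) (I : instance R n m)
    (T : nat) : Prop :=
  exists s : solution n m, optimal_solution I s /\
    forall i, i \in sopen s -> (arrival (dist I) (sroute s) i <= T)%N.

Record lpsol (R : realType) (n m : nat) := LPsol {
  lx : 'I_n -> 'I_m -> nat -> R;
  ly : 'I_n -> nat -> R;
  lz : {set node n} -> nat -> R }.

Record lp_feasible (R : realType) (n m : nat) (I : instance R n m) (ts : seq nat)
    (s : lpsol R n m) : Prop := LPFeasible {
  lp_assign : forall j, 1 <= \sum_i \sum_(t <- ts) lx s i j t;
  lp_open : forall i j t, t \in ts -> lx s i j t <= ly s i t;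
  lp_length : forall t, t \in ts ->
    \sum_(e in complete_edges n) (edge_dist (dist I) e)%:R * lz s e t <= t%:R;
  lp_cut : forall t (S : {set 'I_n}) j, t \in ts ->
    \sum_(i in S) \sum_(t' <- ts | (t' <= t)%N) lx s i j t'
      <= \sum_(e in @cut (complete_graph (node n)) (some @: S)) lz s e t;
  lp_x_ge0 : forall i j t, t \in ts -> 0 <= lx s i j t;
  lp_y_ge0 : forall i t, t \in ts -> 0 <= ly s i t;
  lp_z_ge0 : forall e t, e \in complete_edges n -> t \in ts -> 0 <= lz s e t;
  lp_y_far : forall i t, t \in ts -> (t < dist I (Some i) None)%N -> ly s i t = 0 }.

Definition lp_obj (R : realType) (n m : nat) (I : instance R n m) (ts : seq nat)
    (s : lpsol R n m) : R :=
  \sum_i \sum_(t <- ts) fcost I i * ly s i t +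
  \sum_j \sum_i \sum_(t <- ts) (ccost I i j + t%:R) * lx s i j t.

Definition lp_optimal (R : realType) (n m : nat) (I : instance R n m) (ts : seq nat)
    (s : lpsol R n m) : Prop :=
  lp_feasible I ts s /\
  forall s', lp_feasible I ts s' -> lp_obj I ts s <= lp_obj I ts s'.

Definition Tq (R : realType) (eps : R) (q : nat) : nat := ceiln ((1 + eps) ^+ q).

(* The T_q need not be distinct when eps is small. *)
Definition TS (R : realType) (eps : R) (k : nat) : seq nat :=
  undup [seq Tq eps q | q <- iota 0 k.+1].

Definition is_TS_bound (R : realType) (eps : R) (B k : nat) : Prop :=
  (B <= Tq eps k)%N /\ forall q, (B <= Tq eps q)%N -> (k <= q)%N.

(* TS(x); equal to T_k when no time of TS is at least x. *)
Definition TS_at (R : realType) (eps : R) (k : nat) (x : R) : nat :=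
  \big[minn/Tq eps k]_(t <- TS eps k | x <= t%:R) t.

Record wtree (R : realType) (n : nat) := WTree {
  wgraph :> graph;
  wleaf : node n -> wgraph;
  wlen : {set wgraph} -> R }.

Definition tree_dist (R : realType) (n : nat) (T : wtree R n) (u v : T) : R :=
  \sum_(e <- tree_path_edges u v) wlen e.

Definition embedding_algorithm (R : realType) :=
  forall n : nat, (node n -> node n -> nat) -> ({set node n} -> R) -> wtree R n.

(* K is the constant hidden in the O(log n) of the tree-embedding guarantee. *)
Definition tree_embedding_guarantee (R : realType) (K : R)
    (TE : embedding_algorithm R) : Prop :=
  forall (n : nat) (d : node n -> node n -> nat) (w : {set node n} -> R),
    (1 < n)%N -> is_metric d -> (forall e, e \in complete_edges n -> 0 <= w e) ->
    let T := TE n d w in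
    is_tree T /\
    injective (@wleaf R n T) /\
    (forall v : T, (degree v == 1%N) = (v \in codom (@wleaf R n T))) /\
    (forall e : {set T}, e \in edges T -> 0 <= wlen e) /\
    (forall u v, (d u v)%:R <= tree_dist (@wleaf R n T u) (@wleaf R n T v)) /\
    \sum_(e in complete_edges n) tree_dist (@wleaf R n T (ends e).1) (@wleaf R n T (ends e).2) * w e
      <= K * log2 n%:R * \sum_(e in complete_edges n) (edge_dist d e)%:R * w e.

(* A randomized algorithm is represented by the law of its output. *)
Definition gkr_algorithm (R : realType) :=
  forall (G : graph) (r : G) (p : nat),
    ('I_p -> {set G}) -> ({set G} -> R) -> {set {set G}} -> R.

Definition gkr_guarantee (R : realType) (GKR : gkr_algorithm R) : Prop :=
  forall (G : graph) (r : G) (p : nat) (grp : 'I_p -> {set G}) (w : {set G} -> R)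
         (nu : 'I_p -> R),
    is_tree G -> (1 < #|rooted_leaves r|)%N ->
    (forall j, grp j \subset rooted_leaves r) ->
    (forall e, e \in edges G -> 0 <= w e) ->
    (forall j, 2^-1 <= nu j <= 1) ->
    (forall j (S : {set G}), grp j \subset S -> r \notin S ->
       nu j <= \sum_(e in cut S) w e) ->
    let law := GKR G r p grp w in
    (forall A, 0 <= law A) /\
    \sum_A law A = 1 /\
    (forall A, 0 < law A -> rooted_subtree r A) /\
    (forall e, e \in edges G -> \sum_(A : {set {set G}} | e \in A) law A <= w e) /\
    (forall j, \sum_(A : {set {set G}} | [disjoint subnodes r A & grp j]) law A
       <= expR (- (nu j / (64 * log2 (#|rooted_leaves r|)%:R)))).

(* The tree T' : a dummy leaf v_i = inr i is attached to every facility i. *)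
Definition ext_adj (R : realType) (n : nat) (T : wtree R n) : rel (T + 'I_n)%type :=
  fun a b => match a, b with
  | inl u, inl v => adj u v
  | inl u, inr i | inr i, inl u => u == @wleaf R n T (Some i)
  | inr _, inr _ => false
  end.

Definition ext_graph (R : realType) (n : nat) (T : wtree R n) : graph :=
  Graph (@ext_adj R n T).

Definition ext_node (R : realType) (n : nat) (T : wtree R n) (u : T) : ext_graph T := inl u.

Definition dummy_node (R : realType) (n : nat) (T : wtree R n) (i : 'I_n) : ext_graph T :=
  inr i.

Definition dummy_edge (R : realType) (n : nat) (T : wtree R n) (i : 'I_n) :
    {set ext_graph T} :=
  [set ext_node (@wleaf R n T (Some i)); dummy_node T i].

Definition ext_edge (R : realType) (n : nat) (T : wtree R n) (e : {set T}) :
    {set ext_graph T} := @ext_node R n T @: e.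

(* The part in T of a subgraph of T' : the dummy edges are removed. *)
Definition core (R : realType) (n : nat) (T : wtree R n) (A : {set {set ext_graph T}}) :
    {set {set T}} := [set e in edges T | ext_edge e \in A].

(* Implements "one may assume that i is in T'' iff (i, v_i) is": a facility
   reached without its dummy edge is a dangling leaf, which is cut off. *)
Definition prune (R : realType) (n : nat) (T : wtree R n) (A : {set {set ext_graph T}}) :
    {set {set ext_graph T}} :=
  [set e in A | [forall i, (ext_node (@wleaf R n T (Some i)) \in e) ==>
                            (dummy_edge T i \in A)]].

Definition first_visits (V : eqType) (s : seq V) : seq V := rev (undup (rev s)).

Section Algorithm.

Variables (R : realType) (TE : embedding_algorithm R) (GKR : gkr_algorithm R).
Variables (n m : nat) (I : instance R n m) (eps : R) (k : nat) (s : lpsol R n m).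

Definition Cstar (j : 'I_m) : R :=
  \sum_i \sum_(t <- TS eps k) ccost I i j * lx s i j t.

Definition Lstar (j : 'I_m) : R :=
  \sum_i \sum_(t <- TS eps k) t%:R * lx s i j t.

Definition nbh (j : 'I_m) : {set 'I_n} := [set i | ccost I i j <= 4 * Cstar j].

(* When s is feasible some time qualifies, so the default T_k is irrelevant. *)
Definition tau (j : 'I_m) : nat :=
  \big[minn/Tq eps k]_(t <- TS eps k |
     2 / 3 <= \sum_(i in nbh j) \sum_(t' <- TS eps k | (t' <= t)%N) lx s i j t') t.

Definition taumax : nat := \max_j tau j.

Definition Lbar : R := (\sum_j Lstar j) / m%:R.

(* The usual formula ceil (log2 (2 taumax / Lbar) + 4 log2 m), except that the
   first logarithm is replaced by its nonnegative part. The two agree when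
   Lbar <= 2 taumax. Otherwise the plain formula gives too few phases, or even a
   negative number: an optimal LP solution may put a third of the assignment of
   every client at times arbitrarily larger than taumax. *)
Definition last_phase : nat :=
  ceiln (Num.max 0 (log2 (2 * taumax%:R / Lbar)) + 4 * log2 m%:R).

Definition phase := 'I_last_phase.+1.

Definition ptime (l : phase) : nat := TS_at eps k (Lbar * 2 ^+ l).

Definition ptree (l : phase) : wtree R n := TE (dist I) (fun e => lz s e (ptime l)).

Definition pext (l : phase) : graph := ext_graph (ptree l).

Definition proot (l : phase) : pext l := ext_node (@wleaf R n (ptree l) None).

Definition core_weight (l : phase) (e : {set ptree l}) : R :=
  \sum_(g in complete_edges n | e \in tree_path_edges (@wleaf R n (ptree l) (ends g).1)
                                         (@wleaf R n (ptree l) (ends g).2))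
     lz s g (ptime l).

Definition dummy_weight (l : phase) (i : 'I_n) : R :=
  \sum_(t <- TS eps k | (t <= ptime l)%N) ly s i t.

Definition ext_weight (l : phase) (e : {set pext l}) : R :=
  if [pick i | e == dummy_edge (ptree l) i] is Some i then dummy_weight l i
  else core_weight (@ext_node R n (ptree l) @^-1: e).

Definition pclients (l : phase) : {set 'I_m} := [set j | (tau j <= ptime l)%N].

Definition pgroup (l : phase) (a : 'I_(#|pclients l|)) : {set pext l} :=
  [set dummy_node (ptree l) i | i in nbh (enum_val a)].

Definition gkr_law (l : phase) : {set {set pext l}} -> R :=
  @GKR (pext l) (proot l) _ (@pgroup l) (@ext_weight l).

Definition num_trees : nat := ceiln (log2 (m%:R : R)).

Definition num_exec : nat := ceiln (192 * log2 (n%:R : R)).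

(* An outcome records the results of all the executions of the GKR algorithm:
   execution e for tree q in phase l returned w l (q, e). *)
Definition outcome : finType :=
  {dffun forall l : phase, {ffun 'I_num_trees * 'I_num_exec -> {set {set pext l}}}}.

(* The product law: all executions are independent. *)
Definition prob (w : outcome) : R := \prod_(l : phase) \prod_qe gkr_law (w l qe).

(* The tree T''_q : a union of executions. *)
Definition cand (w : outcome) (l : phase) (q : 'I_num_trees) : {set {set pext l}} :=
  prune (\bigcup_(e : 'I_num_exec) w l (q, e)).

Definition cond_i (l : phase) (A : {set {set pext l}}) : bool :=
  \sum_(i | dummy_edge (ptree l) i \in A) fcost I i <=
  40 * (192 * log2 n%:R) * \sum_i fcost I i * dummy_weight l i.

Definition cond_ii (l : phase) (A : {set {set pext l}}) : bool :=
  \sum_(e in core A) wlen e <=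
  40 * (192 * log2 n%:R) * \sum_(e in edges (ptree l)) wlen e * core_weight e.

Definition good (w : outcome) (l : phase) : {set 'I_num_trees} :=
  [set q | cond_i (cand w l q) && cond_ii (cand w l q)].

(* How "any of the trees satisfying (i) and (ii)" is resolved: in each phase,
   by a rule which only looks at which of the trees satisfy (i) and (ii). *)
Definition selection_rule := phase -> {set 'I_num_trees} -> 'I_num_trees.

Definition valid_rule (sel : selection_rule) : Prop :=
  forall l (Q : {set 'I_num_trees}), Q != set0 -> sel l Q \in Q.

Variable sel : selection_rule.

(* The chosen tree T'_l, without its dummy edges. *)
Definition chosen (w : outcome) (l : phase) : {set {set ptree l}} :=
  core (cand w l (sel l (good w l))).

Definition popen (w : outcome) (l : phase) : {set 'I_n} :=
  [set i | @wleaf R n (ptree l) (Some i) \in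
           subnodes (@wleaf R n (ptree l) None) (chosen w l)].

Definition success (w : outcome) : bool :=
  [forall l, good w l != set0] &&
  [forall j, [exists l, nbh j :&: popen w l != set0]].

Definition is_tour (w : outcome) (l : phase) (tour : seq 'I_n) : Prop :=
  exists2 p : seq (ptree l),
    eulerian_tour_doubled (@wleaf R n (ptree l) None) (chosen w l) p &
    [/\ uniq tour, tour =i popen w l &
        subseq [seq @wleaf R n (ptree l) (Some i) | i <- tour]
               (@wleaf R n (ptree l) None :: p)].

(* sol can be returned by the algorithm on the outcome w; the Eulerian tours
   and the facilities to which the clients get connected are arbitrary. *)
Definition returns (w : outcome) (sol : solution n m) : Prop :=
  exists2 tour : phase -> seq 'I_n, forall l : phase, is_tour w l (tour l) &
  [/\ sopen sol = \bigcup_l popen w l,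
      sroute sol = first_visits (flatten [seq tour l | l <- enum 'I_last_phase.+1]) &
      forall j, exists l : phase,
        (forall l' : phase, (l' < l)%N -> nbh j :&: popen w l' = set0) /\
        sassign sol j \in nbh j :&: popen w l].

Definition prob_success : R := \sum_(w | success w) prob w.

Definition prob_failure : R := \sum_(w | ~~ success w) prob w.

(* Expectation conditioned on success, out w being the solution returned on w. *)
Definition expected_cost (out : outcome -> solution n m) : R :=
  (\sum_(w | success w) prob w * cost I (out w)) / prob_success.

End Algorithm.

(* Main.v *)
Require Import Defs.
From mathcomp Require Import all_boot all_order all_algebra.
From mathcomp Require classical_sets.
From mathcomp Require Import reals sequences exp.
From mathcomp Require Import ring lra.

(** By the choice of N_j, at least 3/4 of the fractional assignment of j
    lies in N_j, and less than 2/3 of it is used before tau_j, so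
    tau_j <= 12 L*_j.  In a phase with t_l >= tau_j the LP cut constraints,
    pushed through the tree embedding and the dummy edges, give the GKR
    hypothesis with nu = 2/3, so one trial misses N_j with probability at most
    exp(-2) <= 1/5.  By Markov each of (i) and (ii) fails for a trial with
    probability at most 1/39.  Hence a phase has no good tree with probability
    at most (2/39)^(log2 m), and, since the selection looks only at which trials
    are good, a phase both succeeds and misses j with probability at most
    (1/5)/(37/39) <= 1/4.  Phase lengths double while the probability that j is
    still unconnected drops by 4, so the expected waiting time of j is within a
    constant of tau_j + Lbar times the O(log^2 n) tour overhead.  Facility costs
    lose O(log n) in each of the O(log m) phases.  Rounding times up to TS turns
    a solution of (P) into one of the restricted program at a cost factor of
    1 + eps. *)

Set Implicit Arguments.
Unset Strict Implicit.
Unset Printing Implicit Defensive.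

Import Order.TTheory GRing.Theory Num.Theory.
Local Open Scope ring_scope.

(** Success involves all phases at once, so conditioning on it would destroy the independence of the
    phases. The argument therefore never works under the conditional law. For each client j, the
    event that every phase before l has a good tree and none of them connects j is a conjunction of
    events about single phases, so its probability is an exact product. On a successful run the wait
    of j is at most the total length of the tours of those phases l for which this event holds. The
    expectation of that sum is taken over all outcomes, and the conditioning costs only a final
    factor 4: failure has probability at most (3/2)/m, which is at most 3/4 for m >= 2.

    The constant in the cost bound depends on an upper bound [eps0] for eps. The nominal phase
    lengths are real numbers, and rounding them up to TS costs a factor 2 + eps, in addition to the
    1 + eps lost between the two programs. The extra factor is absorbed as 2 + |eps0|. *)

Lemma sum_dffun_prod (R : realType) (J : finType) (T_ : J -> finType)
    (F : forall i, T_ i -> R) :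
  \sum_(w : {dffun forall i, T_ i}) \prod_i F i (w i) = \prod_i \sum_(x : T_ i) F i x.
Proof.
(* The trees of different phases live in different types, so outcomes are dependent functions.
   Passing to [fprod] turns them into functions to the tagged union, where the product of sums
   expands. *)
pose P i := [ffun x => F i x].
rewrite (reindex (@dffun_of_fprod J T_)) /=; last first.
  by apply: onW_bij; exact: dffun_of_fprod_bij.
transitivity (\sum_(t : fprod T_) \prod_(i in J) P i (t i)).
  by apply: eq_bigr => f _; apply: eq_bigr => i _; rewrite !ffunE.
rewrite [LHS](@big_fprod R 0 1 *%R +%R J T_ P).
rewrite -[LHS](bigA_distr_big_dep (fun i => mem (tagged_with T_ i)) (fun i => untag 0 (P i))).
apply: eq_bigr => i _; rewrite -(big_tag P i).
by apply: eq_bigr => x _; rewrite ffunE.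
Qed.

(** * Independent trials under a product law *)

Section IndependentTrials.

Variables (R : realType) (J X : finType) (mu : X -> R).
Hypotheses (mu_ge0 : forall x, 0 <= mu x) (mu1 : \sum_x mu x = 1).

Lemma sum_ffun_prod_event (G : J -> pred X) :
  \sum_(v : {ffun J -> X} | [forall q, G q (v q)]) \prod_q mu (v q) =
  \prod_q \sum_(x | G q x) mu x.
Proof.
rewrite bigA_distr_big_dep; apply: eq_bigl => v.
by apply/forallP/familyP.
Qed.

Lemma sum_ffun_prod1 : \sum_(v : {ffun J -> X}) \prod_q mu (v q) = 1.
Proof.
rewrite -(bigA_distr_bigA (fun _ x => mu x)) /=.
by rewrite big1 // => q _; rewrite mu1.
Qed.

Lemma no_good_trial (G : pred X) (p : R) :
  \sum_(x | ~~ G x) mu x <= p ->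
  \sum_(v : {ffun J -> X} | [set q | G (v q)] == set0) \prod_q mu (v q) <= p ^+ #|J|.
Proof.
move=> hp; rewrite (eq_bigl (fun v : {ffun J -> X} => [forall q, ~~ G (v q)])); last first.
  move=> v; apply/eqP/forallP => [v0 q|v0].
    by apply: contraT => /negbNE Gq; have := in_set0 q; rewrite -v0 inE Gq.
  by apply/setP => q; rewrite !inE; apply/negbTE.
rewrite (sum_ffun_prod_event (fun _ x => ~~ G x)) prodr_const cardT -cardE.
by apply: lerXn2r => //; rewrite nnegrE; [exact: sumr_ge0|apply: le_trans hp; exact: sumr_ge0].
Qed.

(* Conditionally on the set of good trials, the trials remain independent and
   each good one keeps its conditional law, whatever good one gets selected. *)
Lemma selected_trial (G U : pred X) (sel : {set J} -> J) (p : R) :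
  0 <= p ->
  (forall Q, Q != set0 -> sel Q \in Q) ->
  \sum_(x | G x && U x) mu x <= p * \sum_(x | G x) mu x ->
  \sum_(v : {ffun J -> X} | ([set q | G (v q)] != set0) &&
        U (v (sel [set q | G (v q)]))) \prod_q mu (v q) <= p.
Proof.
move=> p0 hsel hU.
rewrite (partition_big (fun v : {ffun J -> X} => [set q | G (v q)]) (fun Q => Q != set0)) /=;
  last by move=> v /andP[].
have tot : \sum_(Q : {set J}) \sum_(v : {ffun J -> X} | [set q | G (v q)] == Q)
    \prod_q mu (v q) = 1.
  rewrite -[RHS]sum_ffun_prod1.
  by rewrite (partition_big (fun v : {ffun J -> X} => [set q | G (v q)]) predT).
apply: (@le_trans _ _ (p * \sum_(Q : {set J}) \sum_(v : {ffun J -> X} |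
   [set q | G (v q)] == Q) \prod_q mu (v q))); last by rewrite tot mulr1.
rewrite mulr_sumr big_mkcond /=; apply: ler_sum => Q _.
have nn (A : pred {ffun J -> X}) : 0 <= \sum_(v | A v) \prod_q mu (v q).
  by apply: sumr_ge0 => v _; apply: prodr_ge0 => q _; exact: mu_ge0.
case: ifPn => [Q0|_]; last by rewrite mulr_ge0.
have setE (v : {ffun J -> X}) : ([set q | G (v q)] == Q) = [forall q, G (v q) == (q \in Q)].
  apply/eqP/forallP => [<- q|h]; first by rewrite inE.
  by apply/setP => q; rewrite inE; apply/eqP.
(* For a fixed set Q of good trials the event is a condition on each trial separately; the extra
   one, U, bears only on the trial [sel Q]. *)
under eq_bigl => v.
  have -> : ([set q | G (v q)] != set0) && U (v (sel [set q | G (v q)])) &&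
    ([set q | G (v q)] == Q) =
    [forall q, (G (v q) == (q \in Q)) && ((q == sel Q) ==> U (v q))].
    apply/idP/forallP => [/andP[/andP[_ Us] /eqP vQ] q|h].
      rewrite -vQ inE eqxx /=; apply/implyP => /eqP ->.
      by rewrite vQ in Us *.
    have vQ : [set q | G (v q)] = Q.
      by apply/setP => q; rewrite inE; have /andP[/eqP-> _] := h q.
    rewrite vQ eqxx Q0 andbT /=.
    by have /andP[_ /implyP] := h (sel Q); apply.
  over.
rewrite (sum_ffun_prod_event (fun q x => (G x == (q \in Q)) && ((q == sel Q) ==> U x))).
rewrite (eq_bigl _ _ setE).
rewrite (sum_ffun_prod_event (fun q x => G x == (q \in Q))).
rewrite (bigD1 (sel Q)) //= [in leRHS](bigD1 (sel Q)) //= mulrA.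
apply: ler_pM.
- by apply: sumr_ge0.
- by apply: prodr_ge0 => q _; exact: sumr_ge0.
- rewrite eqxx /=; under eq_bigl do rewrite hsel // eqb_id.
  by under [in leRHS]eq_bigl do rewrite hsel // eqb_id.
- apply: ler_prod => q /negbTE nq; rewrite sumr_ge0 //=.
  rewrite le_eqVlt; apply/orP; left; apply/eqP; apply: eq_bigl => x.
  by rewrite nq andbT.
Qed.

End IndependentTrials.


Lemma markov_sum (R : realType) (X : finType) (mu f : X -> R) (a b M : R) :
  (forall x, 0 <= mu x) -> (forall x, 0 <= f x) -> 0 < a -> 0 <= b -> 0 <= M ->
  \sum_x mu x * f x <= b * M ->
  \sum_(x | ~~ (f x <= a * M)) mu x <= b / a.
Proof.
move=> mu0 f0 a0 b0 M0 hE; have [M00|Mn0] := eqVneq M 0.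
  (* With M = 0 one cannot divide by M; the expectation then vanishes, so every x with f x > 0 has
     mass zero. *)
  rewrite big1 ?divr_ge0 // 1?ltW // => x; rewrite M00 mulr0 -ltNge => fx.
  have /eqP : \sum_x mu x * f x = 0.
    apply/eqP; rewrite eq_le (le_trans hE) ?M00 ?mulr0 //=.
    by apply: sumr_ge0 => y _; exact: mulr_ge0.
  rewrite psumr_eq0; last by move=> y _; exact: mulr_ge0.
  by move=> /allP /(_ x (mem_index_enum x)) /=; rewrite mulf_eq0 (gt_eqF fx) orbF => /eqP.
have Mp : 0 < M by rewrite lt_def Mn0.
rewrite ler_pdivlMr // -(ler_pM2r Mp); apply: le_trans hE.
rewrite !mulr_suml [leRHS](bigID (fun x => f x <= a * M)) /=.
rewrite -[leLHS]add0r; apply: lerD.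
  by apply: sumr_ge0 => x _; exact: mulr_ge0.
by apply: ler_sum => x; rewrite -ltNge -mulrA => /ltW; exact: ler_wpM2l.
Qed.

(** * Walks, simple paths and trees *)

Lemma walk_edges_cat (V : finType) (u : V) p q :
  walk_edges u (p ++ q) = walk_edges u p ++ walk_edges (last u p) q.
Proof. exact: pairmap_cat. Qed.

Lemma walk_edges_sub (V : finType) (u : V) p e :
  e \in walk_edges u p -> e \subset u :: p.
Proof.
elim: p u => [|v p IH] u //=; rewrite inE => /orP[/eqP->|/IH /subsetP h].
  by apply/subsetP => x; rewrite !inE => /orP[]->; rewrite ?orbT.
by apply/subsetP => x /h; rewrite [in X in _ -> X]inE => ->; rewrite orbT.
Qed.

Lemma walk_edges_uniq (V : finType) (u : V) p : uniq (u :: p) -> uniq (walk_edges u p).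
Proof.
elim: p u => [|v p IH] u //= /andP[up vp]; rewrite IH // andbT.
apply/negP => /walk_edges_sub /subsetP /(_ u); rewrite !inE eqxx /= => /(_ isT).
by move=> h; rewrite inE h in up.
Qed.

Lemma walk_cross (V : finType) (S : {set V}) (u : V) p :
  u \in S -> last u p \notin S ->
  exists2 e, e \in walk_edges u p & #|e :&: S| = 1%N.
Proof.
elim: p u => [|v p IH] u uS /=; first by rewrite uS.
move=> lS; have [vS|vS] := boolP (v \in S).
  by have [e ep eS] := IH v vS lS; exists e => //; rewrite inE ep orbT.
exists [set u; v]; first by rewrite inE eqxx.
rewrite (_ : _ :&: S = [set u]) ?cards1 //; apply/setP => x; rewrite !inE.
case: eqVneq => [->|_] /=; first by rewrite uS.
by case: eqVneq => [->|_] //=; apply/negbTE.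
Qed.

Lemma walk_edges_path (V : finType) (r : rel V) (u : V) p e :
  path r u p -> e \in walk_edges u p -> exists a b, r a b /\ e = [set a; b].
Proof.
elim: p u => [|v p IH] u //= /andP[ruv rp]; rewrite inE => /orP[/eqP->|].
  by exists u, v.
exact: IH.
Qed.

Lemma mem_edges (G : graph) (u v : G) : adj u v -> [set u; v] \in edges G.
Proof. by move=> h; apply/imsetP; exists (u, v); rewrite ?inE. Qed.

Lemma edgesP (G : graph) (e : {set G}) :
  reflect (exists u v : G, adj u v /\ e = [set u; v]) (e \in edges G).
Proof.
apply: (iffP imsetP) => [[[u v]]|[u [v [h ->]]]].
  by rewrite inE /= => h ->; exists u, v.
by exists (u, v); rewrite ?inE.
Qed.

Lemma set2_inj (T : finType) (a b c d : T) :
  [set a; b] = [set c; d] -> (a = c /\ b = d) \/ (a = d /\ b = c).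
Proof.
move=> h; have /set2P ha : a \in [set c; d] by rewrite -h set21.
have /set2P hb : b \in [set c; d] by rewrite -h set22.
have /set2P hc : c \in [set a; b] by rewrite h set21.
have /set2P hd : d \in [set a; b] by rewrite h set22.
case: ha hb hc hd => -> [] -> [] ? [] ?; subst; tauto.
Qed.

Lemma edges_adj (G : graph) (u v : G) : symmetric (@adj G) ->
  ([set u; v] \in edges G) = adj u v.
Proof.
move=> sG; apply/edgesP/idP => [[a [b [ab /set2_inj [[-> ->]|[-> ->]]]]]|uv] //.
  by rewrite sG.
by exists u, v.
Qed.

Lemma walk_in_edges (G : graph) (u : G) p e :
  path (@adj G) u p -> e \in walk_edges u p -> e \in edges G.
Proof. by move=> /walk_edges_path h /h [a [b [ab ->]]]; apply: mem_edges. Qed.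

(** When u already occurs on the simplified tail, the loop back to u is cut off; lengths being
    nonnegative, the walk gets no longer. *)
Lemma simplify_walk (R : realType) (G : graph) (len : {set G} -> R) (u : G) p :
  (forall e, e \in edges G -> 0 <= len e) -> path (@adj G) u p ->
  exists2 q, simple_path u (last u p) q &
    \sum_(e <- walk_edges u q) len e <= \sum_(e <- walk_edges u p) len e.
Proof.
move=> len0; elim: p u => [|v p IH] u /=.
  by exists [::] => //; rewrite /simple_path /= eqxx.
move=> /andP[uv vp]; have [q /and3P[vq uvq /eqP lq] hq] := IH v vp.
have huv : 0 <= len [set u; v] by apply: len0; apply: mem_edges.
rewrite big_cons; have [uq|uq] := boolP (u \in v :: q); last first.
  exists (v :: q); last by rewrite /= big_cons lerD2l.
  by rewrite /simple_path cons_uniq uq uvq /= uv vq lq eqxx.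
have sub0 (w : G) s : path (@adj G) w s -> 0 <= \sum_(e <- walk_edges w s) len e.
  by move=> ws; rewrite big_seq; apply: sumr_ge0 => e /(walk_in_edges ws) /len0.
case/splitPl: uq vq uvq lq hq => p1 p2 hu; rewrite cat_path last_cat hu.
move=> /andP[vp1 up2] uq lq hq; exists p2.
  rewrite /simple_path up2 lq eqxx andbT /=.
  move: uq; rewrite -cat_cons cat_uniq => /and3P[_ /hasPn h ->]; rewrite andbT.
  by apply/negP => /h; rewrite /= -hu mem_last.
apply: le_trans (_ : \sum_(e <- walk_edges v p) len e <= _); last by rewrite lerDr.
by apply: le_trans hq; rewrite walk_edges_cat big_cat hu /= lerDr sub0.
Qed.

Section TreePaths.

Variables (G : graph) (hG : is_tree G).

Definition tree_path (u v : G) : seq G :=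
  classical_sets.xget [::] (fun p => simple_path u v p).

Lemma tree_pathP u v : simple_path u v (tree_path u v).
Proof.
have [_ _ /(_ u v) [p [hp _]]] := hG.
exact: (@classical_sets.xgetI _ [::] (fun p => simple_path u v p) p hp).
Qed.

Lemma tree_path_unique (u v : G) p : simple_path u v p -> tree_path u v = p.
Proof.
have [_ _ /(_ u v) [q [_ hq]]] := hG.
by move=> /hq <-; rewrite (hq _ (tree_pathP u v)).
Qed.

Lemma tree_path_edges_unique (u v : G) p :
  simple_path u v p -> tree_path_edges u v = walk_edges u p.
Proof. by move=> /tree_path_unique <-. Qed.

Lemma tree_path_edges_uniq (u v : G) : uniq (tree_path_edges u v).
Proof. by apply: walk_edges_uniq; case/and3P: (tree_pathP u v). Qed.

Lemma tree_path_edges_sub (u v : G) e : e \in tree_path_edges u v -> e \in edges G.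
Proof. by apply: walk_in_edges; case/and3P: (tree_pathP u v). Qed.

Lemma tree_path_cut (S : {set G}) (u v : G) : (u \in S) != (v \in S) ->
  exists2 e, e \in tree_path_edges u v & e \in Defs.cut S.
Proof.
case/and3P: (tree_pathP u v) => hp _ /eqP hl huv.
have [e he eS] : exists2 e, e \in tree_path_edges u v & #|e :&: S| == 1%N.
  have [uS|uS] := boolP (u \in S).
    have [||e he /eqP eS] := @walk_cross _ S u (tree_path u v); rewrite ?hl //.
      by move: huv; rewrite uS; case: (v \in S).
    by exists e.
  (* The path leaves the complement of S; an edge with exactly one end there has its other end in S,
     since loops are excluded. *)
  have [||e he /eqP eS] := @walk_cross _ (~: S) u (tree_path u v); rewrite ?inE ?hl //.
    by move: huv; rewrite (negbTE uS); case: (v \in S).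
  exists e => //; have /edgesP[a [b [ab eab]]] := walk_in_edges hp he.
  have := cardsID S e; rewrite setDE (eqP eS) [in RHS]eab cards2.
  case: eqVneq ab => [->|_ _]; last by rewrite addn1 => -[->].
  by have [_ /(_ b) -> _] := hG.
by exists e; rewrite // inE eS (walk_in_edges hp he).
Qed.

Variables (R : realType) (len : {set G} -> R).
Hypothesis len_ge0 : forall e, e \in edges G -> 0 <= len e.

Lemma tree_dist_le_walk (u : G) p : path (@adj G) u p ->
  \sum_(e <- tree_path_edges u (last u p)) len e <= \sum_(e <- walk_edges u p) len e.
Proof.
move=> hp; have [q hq] := simplify_walk len_ge0 hp.
by rewrite (tree_path_edges_unique hq).
Qed.

Lemma tree_dist_triangle (u v w : G) :
  \sum_(e <- tree_path_edges u w) len e <=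
  \sum_(e <- tree_path_edges u v) len e + \sum_(e <- tree_path_edges v w) len e.
Proof.
have /and3P[huv _ /eqP lv] := tree_pathP u v.
have /and3P[hvw _ /eqP lw] := tree_pathP v w.
have := @tree_dist_le_walk u (tree_path u v ++ tree_path v w).
rewrite cat_path huv lv hvw last_cat lv lw walk_edges_cat lv big_cat /=.
exact.
Qed.

Lemma tree_dist_adj (u v : G) : adj u v -> \sum_(e <- tree_path_edges u v) len e <= len [set u; v].
Proof.
move=> uv; have := @tree_dist_le_walk u [:: v]; rewrite /= uv => /(_ isT).
by rewrite big_cons big_nil addr0.
Qed.

Lemma tree_dist_refl (u : G) : \sum_(e <- tree_path_edges u u) len e = 0.
Proof.
rewrite (@tree_path_edges_unique u u [::]) ?big_nil //.
by rewrite /simple_path /= eqxx.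
Qed.

End TreePaths.

(** Real-valued counterpart of [walk_length], so that the time metric and the tree metric are
    treated alike. *)
Definition rwalk (R : realType) (V : Type) (delta : V -> V -> R) (u : V) (p : seq V) : R :=
  \sum_(x <- pairmap delta u p) x.

(** The leftover distance between the two ends carries the induction, and it later bounds the return
    leg in [tour_length]. *)
Lemma subseq_walk (R : realType) (V : eqType) (delta : V -> V -> R) (x : V) p s :
  (forall u, delta u u = 0) -> (forall u v w, delta u w <= delta u v + delta v w) ->
  subseq s p ->
  rwalk delta x s + delta (last x s) (last x p) <= rwalk delta x p.
Proof.
move=> d0 dt; rewrite /rwalk; elim: p x s => [|y p IH] x s.
  by rewrite subseq0 => /eqP -> /=; rewrite big_nil d0 addr0.
case: s => [|z s] /=.
  move=> _; rewrite big_nil big_cons add0r.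
  have := IH y [::] (sub0seq _); rewrite /= big_nil add0r => h.
  by apply: le_trans (dt x y _) _; rewrite lerD2l.
case: eqVneq => [->|_] h; first by rewrite !big_cons -addrA lerD2l; apply: IH.
have := IH y _ h; rewrite /= !big_cons => h2.
have := dt x y z; lra.
Qed.

Lemma path_edge_rel (V : finType) (A : {set {set V}}) u p :
  path (edge_rel A) u p = all (mem A) (walk_edges u p).
Proof. by elim: p u => [|v p IH] u //=; rewrite IH. Qed.

(** An interior occurrence would have its predecessor and its successor as neighbours, and these
    differ on a simple path. *)
Lemma degree1_interior (G : graph) (u x : G) p :
  symmetric (@adj G) -> path (@adj G) u p -> uniq (u :: p) -> degree x == 1%N ->
  x \in u :: p -> x = u \/ x = last u p.
Proof.
move=> sG hp up dx; rewrite inE => /orP[/eqP->|xp]; first by left.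
case/splitPr: xp hp up => p1 [|y p2]; first by rewrite last_cat; right.
move=> hp up; move: hp; rewrite cat_path => /andP[_ /= /and3P[ux xy _]].
have /cards1P[z /setP hz] := dx.
have hy := hz y; have hu := hz (last u p1).
rewrite !inE xy in hy; rewrite !inE sG ux in hu.
move: up; rewrite -cat_cons cat_uniq => /and3P[_ /hasPn /(_ y)].
rewrite !inE eqxx orbT => /(_ isT) /=.
by rewrite -in_cons (eqP (esym hy)) -(eqP (esym hu)) mem_last.
Qed.

(** * The tree extended by dummy leaves *)

Section ExtendedTree.

Variables (R : realType) (n : nat) (T : wtree R n).

Local Notation leaf := (@wleaf R n T).
Local Notation inT := (fun u : T => inl u : ext_graph T).

(** A dummy node has a single neighbour, so a path entering one between two core nodes would have to
    return through the same leaf. *)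
Lemma ext_path_core (u v : T) (p : seq (ext_graph T)) :
  simple_path (ext_node u) (ext_node v) p ->
  exists2 p', p = [seq ext_node x | x <- p'] & simple_path u v p'.
Proof.
case/and3P; elim: p u => [|[x|i] p IH] u /=.
- by move=> _ _ /eqP[->]; exists [::]; rewrite // /simple_path /= eqxx.
- move=> /andP[ux hp] /andP[nu hu] hl.
  have [q hq /and3P[qp qu ql]] := IH x hp hu hl; subst p; exists (x :: q) => //.
  rewrite /simple_path cons_uniq qu /= ux qp ql !andbT.
  by move: nu; rewrite -map_cons mem_map // => a b [].
- case: p {IH} => [|[y|j] p] //=; rewrite ?andbF //.
  move=> /and3P[/eqP -> /eqP -> _]; rewrite !inE eqxx.
  by rewrite orbT.
Qed.

Lemma ext_path_dummy (u : T) i (p : seq (ext_graph T)) :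
  simple_path (ext_node u) (dummy_node T i) p ->
  exists2 p', p = rcons [seq ext_node x | x <- p'] (dummy_node T i) &
              simple_path u (leaf (Some i)) p'.
Proof.
case/and3P; case/lastP: p => [|p x] //; rewrite last_rcons => hp hu /eqP hx.
subst x; move: hp; rewrite rcons_path => /andP[hp].
case hl: (last _ p) => [y|//] /eqP hy; subst y.
have [|p' -> hp'] := @ext_path_core u (leaf (Some i)) p; last by exists p'.
rewrite /simple_path hp hl eqxx andbT.
by move: hu; rewrite -rcons_cons rcons_uniq => /andP[].
Qed.

Lemma core_path_ext (u v : T) p :
  simple_path u v p -> simple_path (ext_node u) (ext_node v) [seq ext_node x | x <- p].
Proof.
case/and3P => hp hu /eqP hl; rewrite /simple_path -map_cons map_inj_uniq ?hu; last first.
  by move=> a b [].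
rewrite last_map hl eqxx andbT path_map /=.
by rewrite andbT.
Qed.

Lemma dummy_path_ext (u : T) i p :
  simple_path u (leaf (Some i)) p ->
  simple_path (ext_node u) (dummy_node T i)
     (rcons [seq ext_node x | x <- p] (dummy_node T i)).
Proof.
move=> /core_path_ext /and3P[hp hu /eqP hl].
rewrite /simple_path rcons_path hp hl last_rcons eqxx andbT -rcons_cons rcons_uniq hu andbT.
by rewrite -map_cons /= eqxx; apply/mapP => -[].
Qed.

Lemma simple_path_nil (G : graph) (u : G) p : simple_path u u p -> p = [::].
Proof.
case: p => [|x p] //= /and3P[_ /andP[up _] /eqP hl].
by rewrite -hl /= mem_last in up.
Qed.

Lemma dummy_path_start i (b : ext_graph T) (p : seq (ext_graph T)) :
  b != dummy_node T i ->
  simple_path (dummy_node T i) b p <->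
  exists2 q, p = ext_node (leaf (Some i)) :: q &
     simple_path (ext_node (leaf (Some i))) b q /\ dummy_node T i \notin q.
Proof.
move=> bi; split.
  case/and3P; case: p => [|[x|j] p] //; first by move=> _ _ /eqP h; rewrite -h eqxx in bi.
  rewrite cons_uniq => /andP[/eqP -> hp] /andP[ni hu] hl; exists p => //; split.
    by apply/and3P.
  by move: ni; rewrite inE.
move=> [q -> [/and3P[qp qu ql] nq]].
by rewrite /simple_path cons_uniq qu inE (negbTE nq) /= eqxx qp.
Qed.

Hypothesis hT : is_tree T.

Lemma ext_is_tree : is_tree (ext_graph T).
Proof.
have [sT iT uT] := hT; split.
- by move=> [u|i] [v|j] //=; exact: sT.
- by move=> [u|i] //=; exact: iT.
have fromT (u : T) (b : ext_graph T) : exists! p, simple_path (ext_node u) b p.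
  case: b => [v|i].
    have [p [hp pu]] := uT u v; exists [seq ext_node x | x <- p]; split.
      exact: core_path_ext.
    by move=> q /ext_path_core [q' -> /pu ->].
  have [p [hp pu]] := uT u (leaf (Some i)).
  exists (rcons [seq ext_node x | x <- p] (dummy_node T i)); split.
    exact: dummy_path_ext.
  by move=> q /ext_path_dummy [q' -> /pu ->].
move=> [u|i] b; first exact: fromT.
have [->|bi] := eqVneq b (dummy_node T i).
  exists [::]; split; first by rewrite /simple_path /= eqxx.
  by move=> q /simple_path_nil ->.
have [p [hp pu]] := fromT (leaf (Some i)) b.
exists (ext_node (leaf (Some i)) :: p); split; last first.
  by move=> q /(dummy_path_start q bi) [q' -> [/pu -> _]].
apply/(dummy_path_start _ bi); exists p => //; split => //.
case: b bi {pu} hp => [v|j] bi.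
  by move=> /ext_path_core [q -> _]; apply/mapP => -[].
move=> /ext_path_dummy [q -> _]; rewrite mem_rcons inE eq_sym (negbTE bi) /=.
by apply/mapP => -[].
Qed.

Lemma ext_edge_set2 (u v : T) : ext_edge [set u; v] = [set ext_node u; ext_node v].
Proof. by rewrite /ext_edge imsetU1 imset_set1. Qed.

Lemma walk_edges_ext (u : T) p :
  walk_edges (ext_node u) [seq ext_node x | x <- p] = [seq ext_edge e | e <- walk_edges u p].
Proof. by elim: p u => [|v p IH] u //=; rewrite IH ext_edge_set2. Qed.

Lemma ext_node_inj : injective (@ext_node R n T).
Proof. by move=> a b []. Qed.

Lemma ext_edge_inj : injective (@ext_edge R n T).
Proof. exact: (imset_inj ext_node_inj). Qed.

Lemma dummy_edge_inj : injective (@dummy_edge R n T).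
Proof. by move=> i j /set2_inj [[_ []]|[]]. Qed.

Lemma dummy_edge_in i : dummy_edge T i \in edges (ext_graph T).
Proof. by apply: mem_edges; rewrite /= eqxx. Qed.

Lemma ext_edge_neq_dummy e i : ext_edge e != dummy_edge T i.
Proof.
apply/eqP => /setP /(_ (dummy_node T i)); rewrite !inE eqxx orbT => /imsetP[] //.
Qed.

Lemma ext_edge_in e : e \in edges T -> ext_edge e \in edges (ext_graph T).
Proof. by move=> /edgesP[u [v [uv ->]]]; rewrite ext_edge_set2; apply: mem_edges. Qed.

Lemma ext_edgeK e : @ext_node R n T @^-1: ext_edge e = e.
Proof. by apply/setP => x; rewrite inE mem_imset //; exact: ext_node_inj. Qed.

Hypothesis hinj : injective leaf.
Hypothesis hleaf : forall v : T, (degree v == 1%N) = (v \in codom leaf).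

(** Facility leaves gain a second neighbour and the root is excluded, so only dummy nodes remain.
    The tree given to GKR thus has n leaves, which fixes the logarithm in its guarantee. *)
Lemma rooted_leaves_ext :
  rooted_leaves (ext_node (leaf None)) = [set dummy_node T i | i : 'I_n].
Proof.
apply/setP => -[u|i]; rewrite !inE /degree; last first.
  rewrite /= imset_f // (_ : [set _ | _] = [set ext_node (leaf (Some i))]) ?cards1 //.
  by apply/setP => -[v|j]; rewrite !inE.
rewrite [RHS](_ : _ = false); last by apply/imsetP => -[].
apply/negP => /andP[ur]; rewrite (_ : [set _ | _] =
   [set ext_node v | v in [set v | adj u v]] :|:
   [set dummy_node T j | j in [set j | u == leaf (Some j)]]); last first.
  apply/setP => -[v|j]; rewrite !inE.
    rewrite mem_imset; last exact: ext_node_inj.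
    by rewrite inE orbC [X in X || _](_ : _ = false) //; apply/imsetP => -[].
  rewrite mem_imset; last by move=> a b [].
  by rewrite inE [X in X || _](_ : _ = false) //; apply/imsetP => -[].
rewrite cardsU (_ : _ :&: _ = set0) ?cards0 ?subn0; last first.
  apply/setP => x; rewrite !inE; apply/negP => /andP[/imsetP[v _ ->] /imsetP[]] //.
rewrite card_imset; last exact: ext_node_inj.
rewrite card_imset; last by move=> a b [].
have := hleaf u; rewrite /degree; have [/codomP[[i|] ui]|_] := boolP (u \in codom leaf).
- move=> /eqP ->; subst u; rewrite (cardD1 i) !inE eqxx.
  by rewrite addnA addn1.
- by subst u; rewrite eqxx in ur.
move=> /negbT nu /eqP; have [->|[j]] := set_0Vmem [set j | u == leaf (Some j)].
  by rewrite cards0 addn0 => /eqP; rewrite (negbTE nu).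
by rewrite inE => /eqP uj; rewrite uj in nu; move: (hleaf u); rewrite uj /degree (negbTE nu) codom_f.
Qed.

Lemma card_rooted_leaves_ext : #|rooted_leaves (ext_node (leaf None))| = n.
Proof.
by rewrite rooted_leaves_ext card_imset ?card_ord // => a b [].
Qed.

(** Pruning only removes edges at facility leaves whose dummy edge is absent. The simple path to v_i
    uses the dummy edge of i and, having degree one, no other facility leaf can lie on it; so its
    core part survives. *)
Lemma core_prune_reach (A : {set {set ext_graph T}}) i :
  A \subset edges (ext_graph T) ->
  dummy_node T i \in subnodes (ext_node (leaf None)) A ->
  leaf (Some i) \in subnodes (leaf None) (core (prune A)).
Proof.
move=> /subsetP hA; rewrite !inE => /connectP [p0 hp0 hl0].
case/shortenP: hp0 hl0 => p hp up _ hl.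
have [sE _ _] := ext_is_tree.
have hpa : simple_path (ext_node (leaf None)) (dummy_node T i) p.
  rewrite /simple_path up hl eqxx !andbT.
  by apply: sub_path hp => a b /hA; rewrite edges_adj.
have [q hq /and3P[qp qu /eqP ql]] := ext_path_dummy hpa; subst p.
move: hp; rewrite path_edge_rel -cats1 walk_edges_cat walk_edges_ext last_map ql /=.
rewrite all_cat all_map /= andbT => /andP[/allP qA iA].
apply/connectP; exists q; last by rewrite ql.
rewrite path_edge_rel; apply/allP => e eq /=.
rewrite !inE (walk_in_edges qp eq) /=; have /= -> := qA e eq.
apply/forallP => j; apply/implyP; rewrite mem_imset; last exact: ext_node_inj.
move=> /(subsetP (walk_edges_sub eq)) /(degree1_interior _ qp qu).
have [sT _ _] := hT; rewrite hleaf codom_f => /(_ sT isT) [/hinj //|].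
by rewrite ql => /hinj[->].
Qed.

(** This makes budget (i) pay for every opened facility: the edge through which leaf i is reached
    survived pruning, so the dummy edge of i is present. *)
Lemma core_prune_dummy (A : {set {set ext_graph T}}) i :
  leaf (Some i) \in subnodes (leaf None) (core (prune A)) ->
  dummy_edge T i \in prune A.
Proof.
rewrite inE => /connectP [p]; case/lastP: p => [_ /= /hinj //|p x].
rewrite rcons_path last_rcons => /andP[_ hx] xi; subst x; move: hx.
rewrite /edge_rel inE => /andP[_]; rewrite ext_edge_set2 inE => /andP[_ /forallP /(_ i)].
rewrite !inE eqxx orbT /= => iA.
rewrite iA /=; apply/forallP => j; apply/implyP.
by rewrite !inE orbF => /eqP[/hinj[->]].
Qed.

End ExtendedTree.

(** * LP cuts seen in the extended tree *)

Lemma endsP n (g : {set node n}) : g \in complete_edges n ->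
  (ends g).1 != (ends g).2 /\ g = [set (ends g).1; (ends g).2].
Proof.
move=> /(@edgesP (complete_graph (node n))) [u [v [uv gE]]]; rewrite /ends.
case: pickP => [p /andP[p12 /eqP]|/(_ (u, v))] //=.
by rewrite gE eqxx andbT => h; move: uv; rewrite /= h.
Qed.

Lemma ends_cut n (S : {set node n}) (g : {set node n}) :
  g \in @Defs.cut (complete_graph (node n)) S ->
  g \in complete_edges n /\ ((ends g).1 \in S) != ((ends g).2 \in S).
Proof.
rewrite inE => /andP[gE]; split => //; have [h12 gs] := endsP gE.
move: b; rewrite {1}gs; case: (boolP (_ \in S)) => h1; case: (boolP (_ \in S)) => h2 //.
  by rewrite (setIidPl _) ?cards2 ?h12 //; apply/subsetP => x /set2P[]->.
rewrite (_ : _ :&: S = set0) ?cards0 //; apply/setP => x; rewrite !inE.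
apply/negP => /andP[/orP[]/eqP-> h]; [by rewrite h in h1|by rewrite h in h2].
Qed.

Lemma ler_sum_sub (R : realType) (I : finType) (A B : {set I}) (F : I -> R) :
  A \subset B -> (forall i, i \in B -> 0 <= F i) ->
  \sum_(i in A) F i <= \sum_(i in B) F i.
Proof.
move=> /subsetP AB F0; rewrite [leLHS]big_mkcond [leRHS]big_mkcond /=.
apply: ler_sum => i _; case: ifP => [/AB ->//|_].
by case: ifP => // /F0.
Qed.

Section TreeWeights.

Variables (R : realType) (n : nat) (T : wtree R n) (z : {set node n} -> R).
Local Notation leaf := (@wleaf R n T).
Local Notation pathof g := (tree_path_edges (leaf (ends g).1) (leaf (ends g).2)).

Hypothesis hT : is_tree T.
Hypothesis z_ge0 : forall g, g \in complete_edges n -> 0 <= z g.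

(** The [core_weight] of the algorithm, for arbitrary edge values z. *)
Definition routed (e : {set T}) : R := \sum_(g in complete_edges n | e \in pathof g) z g.

Lemma routed_ge0 e : 0 <= routed e.
Proof. by apply: sumr_ge0 => g /andP[/z_ge0]. Qed.

(** Exchange of sums: a simple path repeats no edge, so each of its edges is charged z g once. The
    right side is the quantity bounded by the embedding guarantee. *)
Lemma routed_length :
  \sum_(e in edges T) wlen e * routed e =
  \sum_(g in complete_edges n) tree_dist (leaf (ends g).1) (leaf (ends g).2) * z g.
Proof.
rewrite (eq_bigr (fun e => \sum_(g in complete_edges n)
   if e \in pathof g then wlen e * z g else 0)); last first.
  by move=> e _; rewrite /routed mulr_sumr big_mkcondr.
rewrite exchange_big /=; apply: eq_bigr => g _.
rewrite -big_mkcondr /= /tree_dist mulr_suml.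
rewrite big_uniq /=; last exact: tree_path_edges_uniq.
apply: eq_bigl => e; apply/andP/idP => [[]//|h]; split => //.
exact: (tree_path_edges_sub hT h).
Qed.

(** An edge with exactly one end in F is routed along a tree path that crosses the boundary of S, so
    its full z value loads at least one tree edge of the cut. *)
Lemma routed_cut (S : {set T}) (F : {set 'I_n}) :
  leaf None \notin S -> (forall i, (leaf (Some i) \in S) = (i \in F)) ->
  \sum_(g in @Defs.cut (complete_graph (node n)) (some @: F)) z g <=
  \sum_(e in Defs.cut S) routed e.
Proof.
move=> nS hF; have leafE u : (leaf u \in S) = (u \in some @: F).
  case: u => [i|]; first by rewrite hF mem_imset // => a b [].
  by rewrite (negbTE nS); apply/esym/imsetP => -[].
rewrite /routed (eq_bigr (fun e => \sum_(g in complete_edges n)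
   if e \in pathof g then z g else 0)); last by move=> e _; rewrite big_mkcondr.
rewrite exchange_big /= [leRHS](bigID (fun g => g \in @Defs.cut (complete_graph (node n)) (some @: F))) /=.
rewrite -[leLHS]addr0; apply: lerD; last first.
  apply: sumr_ge0 => g /andP[gE _]; apply: sumr_ge0 => e _.
  by case: ifP => // _; exact: z_ge0.
rewrite [leRHS](eq_bigl (fun g => g \in @Defs.cut (complete_graph (node n)) (some @: F))); last first.
  move=> g /=; apply/andP/idP => [[]//|h]; split => //.
  by case: (ends_cut h).
apply: ler_sum => g /ends_cut [gE hg].
rewrite -!leafE in hg; have [e ep eS] := tree_path_cut hT hg.
rewrite (bigD1 e) //= ep lerDl; apply: sumr_ge0 => e' _.
by case: ifP => // _; exact: z_ge0.
Qed.

Variables (dw : 'I_n -> R) (W : {set ext_graph T} -> R).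
Hypothesis dw_ge0 : forall i, 0 <= dw i.
Hypothesis W_dummy : forall i, W (dummy_edge T i) = dw i.
Hypothesis W_core : forall e, W (ext_edge e) = routed e.

Lemma ext_edgesP f : f \in edges (ext_graph T) ->
  (exists i, f = dummy_edge T i) \/ (exists2 e, e \in edges T & f = ext_edge e).
Proof.
move=> /edgesP [[u|i] [[v|j] [/= uv ->]]] //.
- by right; exists [set u; v]; [exact: mem_edges|rewrite ext_edge_set2].
- by left; exists j; rewrite /dummy_edge (eqP uv).
- by left; exists i; rewrite /dummy_edge (eqP uv) setUC.
Qed.

Lemma extended_weight_ge0 f : f \in edges (ext_graph T) -> 0 <= W f.
Proof.
move=> /ext_edgesP [[i ->]|[e _ ->]]; first by rewrite W_dummy.
by rewrite W_core routed_ge0.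
Qed.

(** A facility whose dummy node lies in S is covered in one of two ways: its leaf is outside S and
    the dummy edge is cut, or its leaf is inside S. The second part is stated with z so that the LP
    cut constraint applies directly. *)
Lemma ext_cut_weight (S : {set ext_graph T}) :
  ext_node (leaf None) \notin S ->
  \sum_(i | (dummy_node T i \in S) && (ext_node (leaf (Some i)) \notin S)) dw i +
  \sum_(g in @Defs.cut (complete_graph (node n))
       (some @: [set i | ext_node (leaf (Some i)) \in S])) z g
  <= \sum_(f in Defs.cut S) W f.
Proof.
move=> rS; set S' := @ext_node R n T @^-1: S.
pose D := [set i | (dummy_node T i \in S) && (ext_node (leaf (Some i)) \notin S)].
pose A := @dummy_edge R n T @: D; pose B := @ext_edge R n T @: Defs.cut S'.
have dAB : [disjoint A & B].
  apply/pred0P => f /=; apply/negP => /andP[/imsetP[i _ ->] /imsetP[e _ /eqP]].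
  by rewrite eq_sym (negbTE (ext_edge_neq_dummy _ _)).
have AB : A :|: B \subset Defs.cut S.
  apply/subsetP => f /setUP[/imsetP[i]|/imsetP[e]]; rewrite !inE.
    move=> /andP[iS nS] ->; rewrite dummy_edge_in /= (_ : _ :&: S = [set dummy_node T i]) ?cards1 //.
    apply/setP => x; rewrite !inE.
    case: (eqVneq x (dummy_node T i)) => [->|_]; first by rewrite iS orbT.
    by rewrite orbF; case: (eqVneq x) => [->|//]; apply/negbTE.
  move=> /andP[eE /eqP eS] ->; rewrite ext_edge_in //=.
  rewrite (_ : _ :&: S = @ext_node R n T @: (e :&: S')).
    by rewrite card_imset ?eS //; exact: ext_node_inj.
  apply/setP => x; rewrite inE; apply/andP/imsetP => [[/imsetP[y ye ->] yS]|[y]].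
    by exists y; rewrite // !inE ye.
  by rewrite !inE => /andP[ye yS] ->; split => //; apply: imset_f.
apply: le_trans (ler_sum_sub AB _); last first.
  by move=> f; rewrite inE => /andP[/extended_weight_ge0].
have -> : \sum_(f in A :|: B) W f = \sum_(f in A) W f + \sum_(f in B) W f.
  by rewrite -bigU //=; apply: eq_bigl => f; rewrite !inE.
apply: lerD.
  rewrite big_imset /=; last by move=> i j _ _; exact: dummy_edge_inj.
  rewrite (eq_bigr _ (fun i _ => W_dummy i)) le_eqVlt; apply/orP; left; apply/eqP.
  by apply: eq_bigl => i; rewrite inE.
rewrite big_imset /=; last by move=> i j _ _; exact: ext_edge_inj.
rewrite (eq_bigr _ (fun i _ => W_core i)).
by apply: routed_cut => [|i]; rewrite !inE.
Qed.

End TreeWeights.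

Lemma ceiln_ge (R : realType) (x : R) : x <= (ceiln x)%:R.
Proof.
rewrite /ceiln; apply: le_trans (ceil_ge x) _.
by rewrite natr_absz ler_int ler_norm.
Qed.

Lemma ceiln_lt (R : realType) (x : R) : 0 <= x -> (ceiln x)%:R < x + 1.
Proof.
move=> x0; rewrite /ceiln natr_absz ger0_norm; last by rewrite ceil_ge0; lra.
by have := ceilB1_lt x; rewrite intrB; lra.
Qed.

Lemma ceiln_le (R : realType) (x : R) (N : nat) : x <= N%:R -> 0 <= x -> (ceiln x <= N)%N.
Proof.
move=> xN x0; rewrite -(@ler_nat R) /ceiln natr_absz ger0_norm ?ceil_ge0; last by lra.
by rewrite -[N%:R]/(N%:~R) ler_int ceil_le_int.
Qed.

Lemma ln2_gt0 (R : realType) : 0 < ln 2 :> R.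
Proof. by apply: ln_gt0; lra. Qed.

Lemma log2_ge1 (R : realType) (n : nat) : (1 < n)%N -> 1 <= log2 (n%:R : R).
Proof.
move=> n1; rewrite /log2 ler_pdivlMr ?ln2_gt0 // mul1r ler_ln ?posrE ?ler_nat //.
by rewrite ltr0n ltnW.
Qed.

(** * Unions of independent executions *)

Section Union.

Variables (R : realType) (E : finType) (Y K : finType) (law : {set Y} -> R).
Hypotheses (law_ge0 : forall A, 0 <= law A) (law1 : \sum_A law A = 1).
Let mu (x : {ffun E -> {set Y}}) : R := \prod_e law (x e).

Lemma prod_law_ge0 x : 0 <= mu x.
Proof. by apply: prodr_ge0 => e _; exact: law_ge0. Qed.

Lemma marginal_law (P : pred {set Y}) e0 :
  \sum_(x : {ffun E -> {set Y}} | P (x e0)) \prod_e law (x e) = \sum_(A | P A) law A.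
Proof.
rewrite (eq_bigl (fun x : {ffun E -> {set Y}} =>
  [forall e, (fun e A => (e == e0) ==> P A) e (x e)])); last first.
  move=> x; apply/idP/forallP => [Px e|/(_ e0)]; last by rewrite eqxx.
  by apply/implyP => /eqP ->.
rewrite (sum_ffun_prod_event _ (fun e A => (e == e0) ==> P A)) (bigD1 e0) //= eqxx.
by rewrite [X in _ * X]big1 ?mulr1 // => e /negbTE ->.
Qed.

(** A union bound for each edge. The map h lets one estimate serve both dummy edges, indexed by
    facilities, and core edges, indexed by edges of T. *)
Lemma expected_union_cost (h : K -> Y) (c : K -> R) (W : K -> R) :
  (forall k, 0 <= c k) ->
  (forall k, \sum_(A : {set Y} | h k \in A) law A <= W k) ->
  \sum_(x : {ffun E -> {set Y}}) (\prod_e law (x e)) *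
     (\sum_(k | h k \in \bigcup_e x e) c k) <= #|E|%:R * \sum_k c k * W k.
Proof.
move=> c0 hW; rewrite (eq_bigr (fun x : {ffun E -> {set Y}} => \sum_k c k *
   ((\prod_e law (x e)) *+ (h k \in \bigcup_e x e)))); last first.
  move=> x _; rewrite mulr_sumr big_mkcond; apply: eq_bigr => k _.
  by case: ifP => _; rewrite ?mulr1n ?mulr0n ?mulr0 // mulrC.
rewrite exchange_big mulr_sumr; apply: ler_sum => k _ /=.
rewrite -mulr_sumr mulrCA ler_wpM2l //.
apply: (@le_trans _ _ (\sum_(x : {ffun E -> {set Y}})
    \sum_e0 (\prod_e law (x e)) *+ (h k \in x e0))).
  apply: ler_sum => x _; case: bigcupP => [[e0 _ ke]|_]; last first.
    by rewrite mulr0n; apply: sumr_ge0 => e _; rewrite mulrn_wge0 // prod_law_ge0.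
  rewrite mulr1n [leRHS](bigD1 e0) //= ke mulr1n lerDl; apply: sumr_ge0 => e _.
  by rewrite mulrn_wge0 // prod_law_ge0.
have -> : #|E|%:R * W k = \sum_(e0 : E) W k by rewrite big_const iter_addr_0 mulr_natl.
rewrite exchange_big; apply: ler_sum => e0 _; apply: le_trans (hW k).
rewrite -(marginal_law (fun A => h k \in A) e0) [leRHS]big_mkcond /=.
by apply: ler_sum => x _; case: (_ \in _); rewrite ?mulr1n ?mulr0n.
Qed.

(** U has to force a miss in every execution only on outcomes of positive mass, because only there
    are the GKR outputs known to be subtrees. *)
Lemma all_miss (P : pred {set Y}) (U : pred {ffun E -> {set Y}}) (q : R) :
  (forall x, U x -> 0 < mu x -> forall e, P (x e)) ->
  \sum_(A | P A) law A <= q ->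
  \sum_(x | U x) \prod_e law (x e) <= q ^+ #|E|.
Proof.
move=> hU hq.
apply: (@le_trans _ _ (\sum_(x : {ffun E -> {set Y}} | [forall e, P (x e)]) mu x)).
  rewrite big_mkcond [leRHS]big_mkcond /=; apply: ler_sum => x _.
  have m0 := prod_law_ge0 x.
  case: ifP => [Ux|_]; last by case: ifP.
  case: ifPn => // nP; rewrite leNgt; apply/negP => m1.
  by move/negP: nP; apply; apply/forallP => e; exact: hU Ux m1 e.
rewrite (sum_ffun_prod_event _ (fun _ => P)) prodr_const cardT -cardE.
have s0 : 0 <= \sum_(A | P A) law A by apply: sumr_ge0.
by apply: lerXn2r => //; rewrite nnegrE //; exact: le_trans hq.
Qed.

End Union.

(** Outcomes are indexed by pairs (trial, execution); currying turns each trial into one independent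
    variable, its block of executions. *)
Definition ffun_curry (J K X : finType) (v : {ffun J * K -> X}) : {ffun J -> {ffun K -> X}} :=
  [ffun q => [ffun e => v (q, e)]].

Lemma sum_ffun_curry (R : realType) (J K X : finType) (law : X -> R)
    (P : pred {ffun J -> {ffun K -> X}}) :
  \sum_(v : {ffun J * K -> X} | P (ffun_curry v)) \prod_qe law (v qe) =
  \sum_(v : {ffun J -> {ffun K -> X}} | P v) \prod_q \prod_e law (v q e).
Proof.
rewrite [RHS](reindex (@ffun_curry J K X)) /=; last first.
  apply: onW_bij; exists (fun v : {ffun J -> {ffun K -> X}} => [ffun qe : J * K => v qe.1 qe.2]) => v.
    by apply/ffunP => -[q e]; rewrite !ffunE.
  by apply/ffunP => q; apply/ffunP => e; rewrite !ffunE.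
apply: eq_bigr => v _; rewrite pair_bigA /=; apply: eq_bigr => -[q e] _.
by rewrite !ffunE.
Qed.

(** * Analysis of a single phase *)

Section OnePhase.

Variables (R : realType) (n : nat) (T : wtree R n) (f dw : 'I_n -> R).
Variables (W : {set ext_graph T} -> R) (law : {set {set ext_graph T}} -> R).
Variables (cw : {set T} -> R).
Local Notation leaf := (@wleaf R n T).
Hypotheses (n1 : (1 < n)%N) (hT : is_tree T) (hinj : injective leaf).
Hypothesis hleaf : forall v : T, (degree v == 1%N) = (v \in codom leaf).
Hypothesis len_ge0 : forall e, e \in edges T -> 0 <= wlen e.
Hypotheses (f_ge0 : forall i, 0 <= f i) (dw_ge0 : forall i, 0 <= dw i).
Hypothesis cw_ge0 : forall e, 0 <= cw e.
Hypothesis W_dummy : forall i, W (dummy_edge T i) = dw i.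
Hypothesis W_core : forall e, W (ext_edge e) = cw e.
Hypotheses (law_ge0 : forall A, 0 <= law A) (law1 : \sum_A law A = 1).
Hypothesis law_supp : forall A, 0 < law A -> rooted_subtree (ext_node (leaf None)) A.
Hypothesis law_edge : forall e, e \in edges (ext_graph T) ->
  \sum_(A : {set {set ext_graph T}} | e \in A) law A <= W e.

Local Notation E := (num_exec R n).
Local Notation X := {ffun 'I_E -> {set {set ext_graph T}}}.
Local Notation budget := (40 * (192 * log2 n%:R)).

Definition trial_tree (x : X) : {set {set ext_graph T}} := prune (\bigcup_e x e).

Definition affordable (A : {set {set ext_graph T}}) : bool :=
  (\sum_(i | dummy_edge T i \in A) f i <= budget * \sum_i f i * dw i) &&
  (\sum_(e in core A) wlen e <= budget * \sum_(e in edges T) wlen e * cw e).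

Definition reached (A : {set {set ext_graph T}}) : {set 'I_n} :=
  [set i | leaf (Some i) \in subnodes (leaf None) (core A)].

Let mu (x : X) : R := \prod_e law (x e).

(** The ceiling in [num_exec] adds at most one execution, which is paid by lowering 40 to 39. *)
Lemma num_exec_budget : E%:R / budget <= 39^-1 :> R.
Proof.
have l1 := log2_ge1 R n1; rewrite ler_pdivrMr; last by lra.
have := @ceiln_lt R (192 * log2 n%:R); rewrite -/(num_exec R n); lra.
Qed.

Lemma affordable_likely :
  \sum_(x | ~~ affordable (trial_tree x)) mu x <= 2 / 39.
Proof.
have mu0 x : 0 <= mu x by apply: prod_law_ge0.
have l1 := log2_ge1 R n1; have hb := num_exec_budget.
have subU x : trial_tree x \subset \bigcup_e x e.
  by apply/subsetP => e; rewrite inE => /andP[].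
have b0 : 0 < budget :> R by lra.
pose P1 x := \sum_(i | dummy_edge T i \in trial_tree x) f i <= budget * \sum_i f i * dw i.
pose P2 x := \sum_(e in core (trial_tree x)) wlen e <=
  budget * \sum_(e in edges T) wlen e * cw e.
have H1 : \sum_(x | ~~ P1 x) mu x <= 39^-1.
  apply: le_trans hb; apply: markov_sum => //.
  - by move=> x; apply: sumr_ge0.
  - by apply: sumr_ge0 => i _; exact: mulr_ge0.
  have := @expected_union_cost R 'I_E _ _ law law_ge0 law1 (@dummy_edge R n T) f dw f_ge0.
  rewrite card_ord => h; apply: le_trans (h _); last first.
    by move=> i; rewrite -W_dummy; apply/law_edge/dummy_edge_in.
  apply: ler_sum => x _; rewrite ler_wpM2l //.
  rewrite big_mkcond [leRHS]big_mkcond /=; apply: ler_sum => i _.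
  by case: ifP => [/(subsetP (subU x)) ->//|_]; case: ifP.
have H2 : \sum_(x | ~~ P2 x) mu x <= 39^-1.
  apply: le_trans hb; apply: markov_sum => //.
  - by move=> x; apply: sumr_ge0 => e; rewrite inE => /andP[/len_ge0].
  - by apply: sumr_ge0 => e /len_ge0 h; exact: mulr_ge0.
  (* The GKR bound covers only genuine edges; elsewhere the cost is set to 0 and the probability
     gets the trivial bound 1. *)
  pose c e := if e \in edges T then @wlen R n T e else 0.
  have c0 e : 0 <= c e by rewrite /c; case: ifP => // /len_ge0.
  pose w e := if e \in edges T then cw e else 1.
  have hw e : \sum_(A : {set {set ext_graph T}} | ext_edge e \in A) law A <= w e.
    rewrite /w; case: ifPn => [eE|_]; first by rewrite -W_core; apply/law_edge/ext_edge_in.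
    rewrite -law1 big_mkcond; apply: ler_sum => A _; by case: ifP.
  have := @expected_union_cost R 'I_E _ _ law law_ge0 law1 (@ext_edge R n T) c w c0 hw.
  rewrite card_ord => h; apply: le_trans (le_trans h _); last first.
    rewrite ler_wpM2l // [leRHS]big_mkcond; apply: ler_sum => e _.
    by rewrite /c /w; case: ifP => // _; rewrite mul0r.
  apply: ler_sum => x _; rewrite ler_wpM2l //.
  rewrite big_mkcond [leRHS]big_mkcond /=; apply: ler_sum => e _.
  have := c0 e; rewrite inE /c; case: (e \in edges T) => /= ce; last by case: ifP.
  by case: ifP => [/(subsetP (subU x)) ->//|_]; case: ifP.
apply: (@le_trans _ _ (39^-1 + 39^-1)); last by lra.
apply: le_trans (lerD H1 H2).
rewrite [leLHS]big_mkcond [X in _ <= X + _]big_mkcond [X in _ <= _ + X]big_mkcond.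
rewrite -big_split /=; apply: ler_sum => x _.
have -> : affordable (trial_tree x) = P1 x && P2 x by [].
by have m0 := mu0 x; case: (P1 x); case: (P2 x) => /=; lra.
Qed.

Lemma expR2_inv_le : expR (- 2) <= 5^-1 :> R.
Proof.
rewrite expRN lef_pV2 ?posrE ?expR_gt0 //.
(* exp(1/2) >= 3/2, and (3/2)^4 = 81/16 exceeds 5. *)
have -> : 2 = 4%:R * 2^-1 :> R by lra.
rewrite expRM_natl; have h : 3 / 2 <= expR 2^-1 :> R.
  by apply: le_trans (expR_ge1Dx _); lra.
by apply: (@le_trans _ _ ((3 / 2) ^+ 4)); [lra|apply: lerXn2r; rewrite ?nnegrE; lra].
Qed.

(** The exponent (2/3)/(64 log n) of one execution, taken 192 log n times, is exactly 2; rounding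
    the count up only helps. *)
Lemma num_exec_miss :
  expR (- (2 / 3 / (64 * log2 n%:R))) ^+ E <= 5^-1 :> R.
Proof.
apply: le_trans expR2_inv_le; rewrite -expRM_natl ler_expR.
have l1 := log2_ge1 R n1; have := ceiln_ge (192 * log2 n%:R : R); rewrite -/E => h.
by rewrite mulrN lerN2 mulrA ler_pdivlMr; lra.
Qed.

Lemma uncovered_unlikely (nb : {set 'I_n}) :
  \sum_(A : {set {set ext_graph T}} |
     [disjoint subnodes (ext_node (leaf None)) A & [set dummy_node T i | i in nb]]) law A
    <= expR (- (2 / 3 / (64 * log2 n%:R))) ->
  \sum_(x | nb :&: reached (trial_tree x) == set0) mu x <= 5^-1.
Proof.
move=> hq; apply: le_trans num_exec_miss; rewrite -[X in _ ^+ X](card_ord E).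
apply: all_miss hq => // x /eqP Ux m0 e.
have he e' : 0 < law (x e').
  rewrite lt_def law_ge0 andbT; apply/eqP => l0.
  by move: m0; rewrite (bigD1 e') //= l0 mul0r ltxx.
apply/pred0P => y /=; apply/negP => /andP[ye /imsetP[i inb yi]]; subst y.
have : i \in nb :&: reached (trial_tree x); last by rewrite Ux inE.
rewrite !inE inb /=.
have := @core_prune_reach R n T hT hinj hleaf (\bigcup_e x e) i.
rewrite !inE; apply.
  apply/bigcupsP => e' _.
  by have /andP[] := law_supp (he e').
move: ye; rewrite !inE; apply: connect_sub => a b ab; apply: connect1.
by apply/bigcupP; exists e.
Qed.

Lemma affordable_uncovered (nb : {set 'I_n}) :
  \sum_(A : {set {set ext_graph T}} |
     [disjoint subnodes (ext_node (leaf None)) A & [set dummy_node T i | i in nb]]) law A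
    <= expR (- (2 / 3 / (64 * log2 n%:R))) ->
  \sum_(x | affordable (trial_tree x) && (nb :&: reached (trial_tree x) == set0)) mu x
    <= 4^-1 * \sum_(x | affordable (trial_tree x)) mu x.
Proof.
move=> /uncovered_unlikely hu; have ha := affordable_likely.
have tot : \sum_x mu x = 1 by rewrite /mu sum_ffun_prod1.
rewrite (bigID (fun x => affordable (trial_tree x))) /= in tot.
apply: (@le_trans _ _ 5^-1); last by lra.
apply: le_trans hu; rewrite big_mkcond [leRHS]big_mkcond; apply: ler_sum => x _.
have := prod_law_ge0 law_ge0 x; rewrite -/(mu x).
by case: affordable => //=; case: ifP.
Qed.

Variable N : nat.
Local Notation V := {ffun 'I_N * 'I_E -> {set {set ext_graph T}}}.

(** With the data of a phase substituted, [phase_trial] and [phase_good] unfold to [cand] and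
    [good], so events of a run can be read as events of single phases. *)
Definition phase_trial (v : V) q : {set {set ext_graph T}} := prune (\bigcup_e v (q, e)).

Definition phase_good (v : V) : {set 'I_N} := [set q | affordable (phase_trial v q)].

Lemma phase_trialE v q : phase_trial v q = trial_tree (ffun_curry v q).
Proof.
by rewrite /phase_trial /trial_tree; congr prune; apply: eq_bigr => e _; rewrite !ffunE.
Qed.

Lemma phase_goodE v :
  phase_good v = [set q | affordable (trial_tree (ffun_curry v q))].
Proof. by apply/setP => q; rewrite !inE phase_trialE. Qed.

Lemma phase_no_good :
  \sum_(v | phase_good v == set0) \prod_qe law (v qe) <= (2 / 39) ^+ N.
Proof.
under eq_bigl do rewrite phase_goodE.
rewrite (sum_ffun_curry law (fun v => [set q | affordable (trial_tree (v q))] == set0)).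
rewrite -[X in _ ^+ X](card_ord N).
have mu0 x : 0 <= mu x by exact: prod_law_ge0.
exact: (no_good_trial _ mu0 affordable_likely).
Qed.

Lemma phase_uncovered (nb : {set 'I_n}) (sel : {set 'I_N} -> 'I_N) :
  (forall Q, Q != set0 -> sel Q \in Q) ->
  \sum_(A : {set {set ext_graph T}} |
     [disjoint subnodes (ext_node (leaf None)) A & [set dummy_node T i | i in nb]]) law A
    <= expR (- (2 / 3 / (64 * log2 n%:R))) ->
  \sum_(v | (phase_good v != set0) &&
     (nb :&: reached (phase_trial v (sel (phase_good v))) == set0)) \prod_qe law (v qe)
    <= 4^-1.
Proof.
move=> hsel hq.
under eq_bigl do rewrite phase_trialE phase_goodE.
rewrite (sum_ffun_curry law (fun v =>
   ([set q | affordable (trial_tree (v q))] != set0) &&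
   (nb :&: reached (trial_tree (v (sel [set q | affordable (trial_tree (v q))]))) == set0))).
have mu0 x : 0 <= mu x by exact: prod_law_ge0.
have mu1 : \sum_x mu x = 1 by rewrite /mu sum_ffun_prod1.
by apply: (selected_trial mu0 mu1 _ hsel (affordable_uncovered hq)); rewrite invr_ge0.
Qed.

End OnePhase.

(** * Rounding times up to TS *)

Lemma bigminn_le (d : nat) (ts : seq nat) (P : pred nat) t :
  t \in ts -> P t -> (\big[minn/d]_(u <- ts | P u) u <= t)%N.
Proof.
elim: ts => [|u ts IH] //; rewrite inE big_cons => /orP[/eqP <- ->|/IH h /h {}h].
  exact: geq_minl.
by case: ifP => // _; exact: leq_trans (geq_minr _ _) h.
Qed.

Lemma bigminn_mem (d : nat) (ts : seq nat) (P : pred nat) :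
  let M := \big[minn/d]_(u <- ts | P u) u in
  M = d \/ (M \in ts) && P M.
Proof.
elim: ts => [|u ts IH] /=; first by rewrite big_nil; left.
rewrite big_cons; case: ifP => Pu; last first.
  by case: IH => [->|/andP[h1 h2]]; [left|right; rewrite inE h1 h2 orbT].
rewrite /minn; case: ifP => _; first by right; rewrite inE eqxx Pu.
by case: IH => [->|/andP[h1 h2]]; [left|right; rewrite inE h1 h2 orbT].
Qed.

Lemma bigminn_sat (d : nat) (ts : seq nat) (P : pred nat) :
  P d -> d \in ts -> let M := \big[minn/d]_(u <- ts | P u) u in (M \in ts) && P M.
Proof. by move=> Pd dts /=; case: (bigminn_mem d ts P) => /= [->|//]; rewrite dts. Qed.

Section Times.

Variables (R : realType) (eps : R) (k : nat).
Hypothesis eps_gt0 : 0 < eps.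
Local Notation ts := (TS eps k).

Lemma pow_ge1 q : 1 <= (1 + eps) ^+ q.
Proof. by rewrite exprn_ege1 // lerDl ltW. Qed.

Lemma Tq_gt0 q : (0 < Tq eps q)%N.
Proof.
rewrite -(@ltr_nat R); apply: lt_le_trans (ceiln_ge _).
by have := pow_ge1 q; lra.
Qed.

Lemma Tq_mono q q' : (q <= q')%N -> (Tq eps q <= Tq eps q')%N.
Proof.
move=> qq; apply: ceiln_le; last by have := pow_ge1 q; lra.
by apply: le_trans (ceiln_ge _); apply: ler_weXn2l => //; rewrite lerDl ltW.
Qed.

Lemma mem_TS t : reflect (exists2 q, (q <= k)%N & t = Tq eps q) (t \in ts).
Proof.
rewrite mem_undup; apply: (iffP mapP) => [[q]|[q qk ->]].
  by rewrite mem_iota add0n ltnS => qk ->; exists q.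
by exists q => //; rewrite mem_iota add0n ltnS.
Qed.

Lemma TS_uniq : uniq ts. Proof. exact: undup_uniq. Qed.

Lemma TS_gt0 t : t \in ts -> (0 < t)%N.
Proof. by move=> /mem_TS[q _ ->]; exact: Tq_gt0. Qed.

Lemma TS_le t : t \in ts -> (t <= Tq eps k)%N.
Proof. by move=> /mem_TS[q qk ->]; exact: Tq_mono. Qed.

Lemma Tqk_TS : Tq eps k \in ts.
Proof. by apply/mem_TS; exists k. Qed.

Lemma TS_at_in x : TS_at eps k x \in ts.
Proof.
case: (bigminn_mem (Tq eps k) ts (fun t => x <= t%:R)) => [e|/andP[]//].
by rewrite /TS_at e Tqk_TS.
Qed.

Lemma TS_at_ge x : x <= (Tq eps k)%:R -> x <= (TS_at eps k x)%:R.
Proof.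
move=> xk.
by case/andP: (@bigminn_sat (Tq eps k) ts (fun t => x <= t%:R) xk Tqk_TS).
Qed.

Lemma TS_at_big x : (Tq eps k)%:R <= x -> TS_at eps k x = Tq eps k.
Proof.
move=> kx; case: (bigminn_mem (Tq eps k) ts (fun t => x <= t%:R)) => // /andP[h1 h2].
apply/eqP; rewrite eqn_leq TS_le //= -(@ler_nat R).
exact: le_trans kx h2.
Qed.

(* The factor 2 + eps instead of 1 + eps pays for the ceiling in T_q. *)
Lemma TS_at_le x : 1 <= x -> (TS_at eps k x)%:R <= (2 + eps) * x.
Proof.
move=> x1; have e0 := eps_gt0; have [kx|kx] := leP x (Tq eps k)%:R; last first.
  rewrite TS_at_big ?(ltW kx) //; apply: le_trans (ltW kx) _.
  by rewrite ler_peMl //; lra.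
have ex : exists q, x <= (Tq eps q)%:R by exists k.
case: (ex_minnP ex) => -[|q] xq qmin.
  have -> : TS_at eps k x = Tq eps 0.
    apply/eqP; rewrite eqn_leq bigminn_le //; last by apply/mem_TS; exists 0%N.
    by have /mem_TS[q _ ->] := TS_at_in x; rewrite Tq_mono.
  have : (Tq eps 0 <= 1)%N by apply: ceiln_le; rewrite expr0.
  rewrite -(@ler_nat R) => h; apply: le_trans h _.
  by apply: (le_trans x1); rewrite ler_peMl //; lra.
have qk : (q.+1 <= k)%N by exact: qmin.
have h1 : (TS_at eps k x <= Tq eps q.+1)%N.
  by apply: bigminn_le => //; apply/mem_TS; exists q.+1.
have h2 : (1 + eps) ^+ q < x.
  apply: le_lt_trans (ceiln_ge _) _; rewrite -/(Tq eps q) ltNge; apply/negP => /qmin.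
  by rewrite ltnn.
have h3 : (Tq eps q.+1)%:R < (1 + eps) ^+ q.+1 + 1.
  by apply: ceiln_lt; have := pow_ge1 q.+1; lra.
rewrite -(@ler_nat R) in h1; rewrite exprS in h3.
have : (1 + eps) * (1 + eps) ^+ q <= (1 + eps) * x by rewrite ler_wpM2l //; lra.
lra.
Qed.

(** For an integer t, T_q < t gives (1 + eps)^q + 1 <= t, and this spare unit absorbs the ceiling in
    T_(q+1). Hence the exact factor 1 + eps. *)
Lemma TS_at_nat_le (t : nat) : (0 < t)%N -> (t <= Tq eps k)%N ->
  (TS_at eps k t%:R)%:R <= (1 + eps) * t%:R :> R.
Proof.
move=> t0 tk; have e0 := eps_gt0.
have ex : exists q, (t <= Tq eps q)%N by exists k.
case: (ex_minnP ex) => -[|q] tq qmin.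
  have : (Tq eps 0 <= 1)%N by apply: ceiln_le; rewrite expr0.
  have h : (TS_at eps k t%:R <= Tq eps 0)%N.
    by apply: bigminn_le; rewrite ?ler_nat //; apply/mem_TS; exists 0%N.
  move=> /(leq_trans h) /leq_trans /(_ t0); rewrite -(@ler_nat R) => h'.
  by apply: le_trans h' _; rewrite ler_peMl //; lra.
have qk : (q.+1 <= k)%N by exact: qmin.
have h1 : (TS_at eps k t%:R <= Tq eps q.+1)%N.
  by apply: bigminn_le; rewrite ?ler_nat //; apply/mem_TS; exists q.+1.
have h2 : (1 + eps) ^+ q + 1 <= t%:R.
  have : (Tq eps q < t)%N by rewrite ltnNge; apply/negP => /qmin; rewrite ltnn.
  by rewrite -(@ler_nat R) -natr1; apply: le_trans; rewrite lerD2r ceiln_ge.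
have h3 : (Tq eps q.+1)%:R < (1 + eps) ^+ q.+1 + 1.
  by apply: ceiln_lt; have := pow_ge1 q.+1; lra.
rewrite -(@ler_nat R) in h1; rewrite exprS in h3.
have : (1 + eps) * ((1 + eps) ^+ q + 1) <= (1 + eps) * t%:R by rewrite ler_wpM2l //; lra.
lra.
Qed.

End Times.

(** * Consequences of the LP constraints for a client *)

Section LPFacts.

Variables (R : realType) (n m : nat) (I : instance R n m) (eps : R) (k : nat).
Variable s : lpsol R n m.
Hypotheses (eps_gt0 : 0 < eps) (hs : lp_feasible I (TS eps k) s).
Local Notation ts := (TS eps k).

Definition mass (j : 'I_m) (t : nat) : R :=
  \sum_(i in nbh I eps k s j) \sum_(t' <- ts | (t' <= t)%N) lx s i j t'.

Lemma sum_x_ge0 i j (P : pred nat) : 0 <= \sum_(t <- ts | P t) lx s i j t.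
Proof.
by rewrite big_seq_cond; apply: sumr_ge0 => t /andP[tts _]; exact: (lp_x_ge0 hs).
Qed.

Lemma Cstar_ge0 j : 0 <= Cstar I eps k s j.
Proof.
apply: sumr_ge0 => i _; rewrite -mulr_sumr mulr_ge0 ?sum_x_ge0 //.
exact: ccost_ge0.
Qed.

Lemma mass_total j :
  3 / 4 <= \sum_(i in nbh I eps k s j) \sum_(t <- ts) lx s i j t.
Proof.
pose X i := \sum_(t <- ts) lx s i j t.
have X0 i : 0 <= X i by exact: sum_x_ge0.
have := lp_assign hs j; rewrite (bigID (mem (nbh I eps k s j))) /= -/(X _) => h1.
suff : \sum_(i | i \notin nbh I eps k s j) X i <= 4^-1 by rewrite /X; lra.
have C0 := Cstar_ge0 j.
have CE : Cstar I eps k s j = \sum_i ccost I i j * X i.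
  by apply: eq_bigr => i _; rewrite mulr_sumr.
have term0 i : 0 <= ccost I i j * X i by rewrite mulr_ge0 // ccost_ge0.
have [C00|Cn0] := eqVneq (Cstar I eps k s j) 0.
  (* With C* = 0 Markov's inequality cannot be divided through; but then facilities outside N_j have
     positive cost and carry no assignment. *)
  rewrite big1 ?invr_ge0 // => i; rewrite inE -ltNge C00 mulr0 => ci.
  move: C00; rewrite CE => /eqP; rewrite psumr_eq0 //.
  move=> /allP /(_ i (mem_index_enum i)) /=.
  by rewrite mulf_eq0 (gt_eqF ci) => /eqP.
have Cp : 0 < Cstar I eps k s j by rewrite lt_def Cn0.
rewrite -(ler_pM2l (_ : 0 < 4 * Cstar I eps k s j)); last by lra.
rewrite mulr_sumr (_ : _ / 4 = Cstar I eps k s j); last by lra.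
rewrite [leRHS]CE [leRHS](bigID (mem (nbh I eps k s j))) /=.
rewrite -[leLHS]add0r; apply: lerD; first by apply: sumr_ge0.
by apply: ler_sum => i; rewrite inE -ltNge => /ltW h; exact: ler_wpM2r.
Qed.

Lemma massP j t : (tau I eps k s j <= t)%N -> 2 / 3 <= mass j t.
Proof.
move=> jt; have /andP[_ /le_trans] : (tau I eps k s j \in ts) && (2 / 3 <= mass j (tau I eps k s j)).
  (* The default T_k of the minimum qualifies too, all the mass in N_j being used by then; so [tau]
     really attains 2/3. *)
  apply: (@bigminn_sat _ ts (fun t => 2 / 3 <= mass j t)); last exact: Tqk_TS.
  apply: le_trans (_ : 3 / 4 <= _); first by lra.
  apply: le_trans (mass_total j) _; apply: ler_sum => i _.
  rewrite [leRHS]big_mkcond /= [leLHS]big_seq [leRHS]big_seq; apply: ler_sum => u uts.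
  by rewrite (TS_le eps_gt0 uts).
apply; apply: ler_sum => i _.
rewrite [leLHS]big_mkcond [leRHS]big_mkcond /= [leLHS]big_seq [leRHS]big_seq.
apply: ler_sum => u uts; case: ifP => [ut|_]; first by rewrite (leq_trans ut jt).
by case: ifP => // _; exact: (lp_x_ge0 hs).
Qed.

Lemma tau_TS j : tau I eps k s j \in ts.
Proof.
case: (bigminn_mem (Tq eps k) ts (fun t => 2 / 3 <= mass j t)) => [e|/andP[]//].
by rewrite /tau e Tqk_TS.
Qed.

(** The induction avoids naming the predecessor of tau in TS: an integer outside TS adds nothing,
    and at a time of TS below tau the minimality of tau applies. *)
Lemma mass_before j b : (b <= tau I eps k s j)%N ->
  \sum_(i in nbh I eps k s j) \sum_(t <- ts | (t < b)%N) lx s i j t < 2 / 3.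
Proof.
elim: b => [|b IH] hb.
  by rewrite big1 => [|i _]; [lra|rewrite big_pred0].
have [bts|bts] := boolP (b \in ts).
  rewrite ltNge; apply/negP => hm; have := @bigminn_le (Tq eps k) ts (fun t => 2 / 3 <= mass j t) b bts hm.
  by rewrite leqNgt hb.
rewrite (eq_bigr (fun i => \sum_(t <- ts | (t < b)%N) lx s i j t)); first by apply: IH; exact: ltnW.
move=> i _; rewrite big_seq_cond [RHS]big_seq_cond; apply: eq_bigl => t.
case: (boolP (t \in ts)) => //= tts; rewrite ltnS leq_eqVlt.
by case: eqVneq => // tb; rewrite -tb tts in bts.
Qed.

Lemma tau_Lstar j : (tau I eps k s j)%:R <= 12 * Lstar eps k s j.
Proof.
set T := tau _ _ _ _ _.
pose Y := \sum_(i in nbh I eps k s j) \sum_(t <- ts | (T <= t)%N) lx s i j t.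
(* 3/4 - 2/3 = 1/12. *)
have hY : 12^-1 <= Y.
  have := mass_total j; have := mass_before (leqnn T).
  under [X in _ -> _ <= X -> _]eq_bigr do rewrite (bigID (fun t => (t < T)%N)) /=.
  rewrite big_split /=.
  under [X in _ -> _ <= _ + X -> _]eq_bigr do under eq_bigl do rewrite -leqNgt.
  rewrite -/Y; lra.
have hL : T%:R * Y <= Lstar eps k s j.
  rewrite /Y /Lstar mulr_sumr [leLHS]big_mkcond /=; apply: ler_sum => i _.
  case: ifP => _; last first.
    rewrite big_seq; apply: sumr_ge0 => t tts.
    by rewrite mulr_ge0 // (lp_x_ge0 hs).
  rewrite mulr_sumr [leLHS]big_mkcond /= [leLHS]big_seq [leRHS]big_seq; apply: ler_sum => t tts.
  have x0 := lp_x_ge0 hs i j tts.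
  by case: ifP => [Tt|_]; [rewrite ler_wpM2r // ler_nat|rewrite mulr_ge0].
have : T%:R * 12^-1 <= T%:R * Y by rewrite ler_wpM2l.
lra.
Qed.

Lemma Lstar_ge1 j : 1 <= Lstar eps k s j.
Proof.
apply: le_trans (lp_assign hs j) _; apply: ler_sum => i _.
rewrite [leLHS]big_seq [leRHS]big_seq; apply: ler_sum => t tts.
by rewrite ler_peMl ?(lp_x_ge0 hs) // ler1n (TS_gt0 eps_gt0 tts).
Qed.

Lemma lp_objE :
  lp_obj I ts s = \sum_i \sum_(t <- ts) fcost I i * ly s i t +
    \sum_j Cstar I eps k s j + \sum_j Lstar eps k s j.
Proof.
rewrite /lp_obj -addrA -big_split /=; congr (_ + _); apply: eq_bigr => j _.
rewrite /Cstar /Lstar -big_split /=; apply: eq_bigr => i _.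
by rewrite -big_split /=; apply: eq_bigr => t _; rewrite mulrDl.
Qed.

End LPFacts.

(** * From (P) to the restricted program *)

Lemma sum_regroup (R : realType) (ts r : seq nat) (sg : nat -> nat) (P : pred nat)
    (F G : nat -> R) :
  uniq ts -> (forall t, t \in r -> sg t \in ts) ->
  \sum_(t' <- ts | P t') G t' * (\sum_(t <- r | sg t == t') F t) =
  \sum_(t <- r | P (sg t)) G (sg t) * F t.
Proof.
move=> uts hsg.
transitivity (\sum_(t' <- ts) \sum_(t <- r)
    if (sg t == t') && P t' then G t' * F t else 0).
  rewrite big_mkcond; apply: eq_bigr => t' _; case: ifP => Pt'; last first.
    by rewrite big1 // => t _; rewrite andbF.
  rewrite mulr_sumr big_mkcond; apply: eq_bigr => t _.
  by rewrite andbT.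
rewrite exchange_big /= [RHS]big_mkcond /= [LHS]big_seq [RHS]big_seq.
apply: eq_bigr => t tr; rewrite (bigD1_seq (sg t)) ?hsg //= eqxx /= big1 ?addr0 // => t' /negbTE.
by rewrite eq_sym => ->.
Qed.

Section Rounding.

Variables (R : realType) (n m : nat) (I : instance R n m) (eps : R) (k T : nat).
Variable s : lpsol R n m.
Hypotheses (eps_gt0 : 0 < eps) (T_gt0 : (0 < T)%N) (Tk : (T <= Tq eps k)%N).
Hypothesis hs : lp_feasible I (iota 1 T) s.
Local Notation ts := (TS eps k).
Local Notation sg := (fun t : nat => TS_at eps k (t%:R : R)).

(** Assignments and openings move to their rounded times. The values z at t' are copied from min(t',
    T), since (P) has no time beyond its horizon T. *)
Definition round_lp : lpsol R n m := LPsol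
  (fun i j t' => \sum_(t <- iota 1 T | sg t == t') lx s i j t)
  (fun i t' => \sum_(t <- iota 1 T | sg t == t') ly s i t)
  (fun e t' => lz s e (minn t' T)).

Lemma sg_in t : sg t \in ts.
Proof. exact: TS_at_in. Qed.

Lemma mem_horizon t : (t \in iota 1 T) = (0 < t <= T)%N.
Proof. by rewrite mem_iota add1n ltnS. Qed.

(** T <= T_k keeps [TS_at] away from its truncation at T_k, which would move times down. *)
Lemma sg_ge t : t \in iota 1 T -> (t <= sg t)%N.
Proof.
rewrite mem_horizon => /andP[_ tT]; rewrite -(@ler_nat R); apply: TS_at_ge => //.
by rewrite ler_nat (leq_trans tT).
Qed.

Lemma sum_round (P : pred nat) (F G : nat -> R) :
  \sum_(t' <- ts | P t') G t' * (\sum_(t <- iota 1 T | sg t == t') F t) =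
  \sum_(t <- iota 1 T | P (sg t)) G (sg t) * F t.
Proof. by apply: (@sum_regroup R ts (iota 1 T) sg) => [|t _]; [exact: TS_uniq|exact: sg_in]. Qed.

Lemma sum_round1 (P : pred nat) (F : nat -> R) :
  \sum_(t' <- ts | P t') (\sum_(t <- iota 1 T | sg t == t') F t) =
  \sum_(t <- iota 1 T | P (sg t)) F t.
Proof.
have := sum_round P F (fun _ => 1).
under eq_bigr do rewrite mul1r.
by under [X in _ = X -> _]eq_bigr do rewrite mul1r.
Qed.

Lemma minn_horizon t' : t' \in ts -> minn t' T \in iota 1 T.
Proof.
by move=> t'ts; rewrite mem_horizon leq_min T_gt0 (TS_gt0 eps_gt0 t'ts) geq_minr.
Qed.

Lemma round_feasible : lp_feasible I ts round_lp.
Proof.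
split => /=.
- move=> j; apply: le_trans (lp_assign hs j) _; rewrite le_eqVlt; apply/orP; left; apply/eqP.
  by apply: eq_bigr => i _; rewrite (sum_round1 predT).
- move=> i j t' _; rewrite big_seq_cond [leRHS]big_seq_cond.
  by apply: ler_sum => t /andP[tT _]; exact: (lp_open hs).
- move=> t' t'ts; apply: le_trans (lp_length hs (minn_horizon t'ts)) _.
  by rewrite ler_nat geq_minl.
(* Mass rounded to a time at most t' started no later than t' and within the horizon, so the
   constraint at min(t', T) covers it. *)
- move=> t' S j t'ts; apply: le_trans (lp_cut hs S j (minn_horizon t'ts)).
  apply: ler_sum => i _; rewrite (sum_round1 (fun t => (t <= t')%N)).
  rewrite [leLHS]big_mkcond [leRHS]big_mkcond [leLHS]big_seq [leRHS]big_seq /=.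
  apply: ler_sum => t tT; have := lp_x_ge0 hs i j tT; have := sg_ge tT.
  move: tT; rewrite mem_horizon leq_min => /andP[_ ->] tsg x0; rewrite andbT.
  by case: ifP => [/(leq_trans tsg) ->//|_]; case: ifP.
- move=> i j t' _; rewrite big_seq_cond; apply: sumr_ge0 => t /andP[tT _].
  exact: (lp_x_ge0 hs).
- move=> i t' _; rewrite big_seq_cond; apply: sumr_ge0 => t /andP[tT _].
  exact: (lp_y_ge0 hs).
- by move=> e t' eE t'ts; apply: (lp_z_ge0 hs) => //; exact: minn_horizon.
- move=> i t' _ far; rewrite big_seq_cond big1 // => t /andP[tT /eqP st'].
  apply: (lp_y_far hs tT); apply: leq_ltn_trans far.
  by rewrite -st' sg_ge.
Qed.

Lemma round_obj : lp_obj I ts round_lp <= (1 + eps) * lp_obj I (iota 1 T) s.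
Proof.
have e0 := eps_gt0.
rewrite /lp_obj mulrDr; apply: lerD; rewrite mulr_sumr.
  apply: ler_sum => i _; rewrite (sum_round predT (ly s i) (fun _ => fcost I i)).
  rewrite ler_peMl //; last by lra.
  rewrite big_seq; apply: sumr_ge0 => t tT.
  by rewrite mulr_ge0 ?fcost_ge0 // (lp_y_ge0 hs).
apply: ler_sum => j _; rewrite mulr_sumr; apply: ler_sum => i _.
rewrite (sum_round predT (lx s i j) (fun t => ccost I i j + t%:R)) mulr_sumr.
rewrite big_seq [leRHS]big_seq; apply: ler_sum => t tT; rewrite mulrA.
rewrite ler_wpM2r ?(lp_x_ge0 hs) //.
move: tT; rewrite mem_horizon => /andP[t0 tT].
have := @TS_at_nat_le R eps k e0 t t0 (leq_trans tT Tk).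
have c0 : 0 <= ccost I i j by exact: ccost_ge0.
have : 0 <= eps * ccost I i j by rewrite mulr_ge0 // ltW.
lra.
Qed.

End Rounding.

Lemma restricted_lp_obj (R : realType) n m (I : instance R n m) (eps : R) k T
    (opt s : lpsol R n m) :
  (0 < m)%N -> 0 < eps -> (T <= Tq eps k)%N ->
  lp_feasible I (iota 1 T) opt -> lp_optimal I (TS eps k) s ->
  lp_obj I (TS eps k) s <= (1 + eps) * lp_obj I (iota 1 T) opt.
Proof.
move=> m0 e0 Tk ho [_ hs].
(* With horizon 0 the assignment constraint of any client would read 1 <= 0. *)
have T0 : (0 < T)%N.
  case: T ho {Tk} => // ho; have := lp_assign ho (Ordinal m0).
  by rewrite big1 ?ler10 // => i _; rewrite big_nil.
exact: le_trans (hs _ (round_feasible e0 T0 Tk ho)) (round_obj e0 Tk ho).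
Qed.

(** * Numerical estimates *)

Lemma log2_le_pow (R : realType) (x : R) (N : nat) : 0 < x -> log2 x <= N%:R -> x <= 2 ^+ N.
Proof.
move=> x0; rewrite /log2 ler_pdivrMr ?ln2_gt0 // => h.
by rewrite -ler_ln ?posrE ?exprn_gt0 // lnXn // -[leRHS]mulr_natl.
Qed.

Lemma log2_pow (R : realType) (N : nat) : log2 (2 ^+ N) = N%:R :> R.
Proof. by rewrite /log2 lnXn // -[ln 2 *+ N]mulr_natl mulfK // gt_eqF ?ln2_gt0. Qed.

Lemma log2M (R : realType) (x y : R) : 0 < x -> 0 < y -> log2 (x * y) = log2 x + log2 y.
Proof. by move=> x0 y0; rewrite /log2 lnM ?posrE // mulrDl. Qed.

Lemma ler_log2 (R : realType) (x y : R) : 0 < x -> x <= y -> log2 x <= log2 y.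
Proof.
move=> x0 xy; rewrite /log2 ler_pM2r ?invr_gt0 ?ln2_gt0 // ler_ln ?posrE //.
exact: lt_le_trans xy.
Qed.

(* L 2^b is the length scale of phase b and Q b the probability that phase b is
   reached: once L 2^b exceeds tau, L 2^b Q b at least halves at every phase. *)
Lemma geometric_phases (R : realType) (L tau : R) (Q : nat -> R) (N : nat) :
  0 <= L -> 0 <= tau -> (forall b, 0 <= Q b <= 1) ->
  (forall b, (b < N)%N -> tau <= L * 2 ^+ b -> Q b.+1 <= Q b / 4) ->
  \sum_(b < N.+1) L * 2 ^+ b * Q b <= 6 * tau + 2 * L.
Proof.
move=> L0 t0 Q01 hQ.
have S0 b : 0 <= L * 2 ^+ b by rewrite mulr_ge0 // exprn_ge0.
have S0Q b : 0 <= L * 2 ^+ b * Q b by case/andP: (Q01 b) => q0 _; exact: mulr_ge0.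
have SQ b : L * 2 ^+ b * Q b <= L * 2 ^+ b by rewrite ler_piMr //; case/andP: (Q01 b).
(* The crude bound Q <= 1, summed geometrically, for scales still below tau. *)
have A c : \sum_(b < c.+1) L * 2 ^+ b * Q b <= L * 2 ^+ c.+1.
  elim: c => [|c IH]; first by rewrite big_ord1; have := SQ 0%N; rewrite expr1 expr0; lra.
  rewrite big_ord_recr /=; have := SQ c.+1; move: IH; rewrite !exprS; lra.
(* Counting the last term twice gives a potential that stops growing once the scale reaches tau, as
   the next term is then at most half the last. While L 2^c < tau, its value at c + 1 is at most 3 L
   2^(c+1) = 6 L 2^c < 6 tau; at c = 0 it is at most 2 L. *)
suff B c : (c <= N)%N ->
    \sum_(b < c.+1) L * 2 ^+ b * Q b + L * 2 ^+ c * Q c <= 6 * tau + 2 * L.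
  by have := B N (leqnn N); have := S0Q N; lra.
elim: c => [_|c IH cN]; first by rewrite big_ord1; have := SQ 0%N; rewrite expr0; lra.
rewrite big_ord_recr /=; have [tc|tc] := leP tau (L * 2 ^+ c).
  have := IH (ltnW cN); have := ler_wpM2l (S0 c) (hQ c cN tc); rewrite exprS; lra.
have := A c; have := SQ c.+1; rewrite !exprS; lra.
Qed.

(** Factors 2^-N <= 1/m are split off. With N (4/39)^N <= 4/39 the first term is at most (48/39)/m,
    the second is at most 1/(4m), and 48/39 + 1/4 < 3/2. *)
Lemma phase_failure_sum (R : realType) (N m : nat) : (0 < N)%N -> (m%:R : R) <= 2 ^+ N -> (0 < m)%N ->
  (12 * N%:R) * (2 / 39) ^+ N + m%:R * 4^-1 ^+ N.+1 <= (3 / 2) / m%:R :> R.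
Proof.
move=> N0 mN m0; have mp : 0 < (m%:R : R) by rewrite ltr0n.
have hN : N%:R * (4 / 39) ^+ N <= 4 / 39 :> R.
  elim: N N0 {mN} => [//|[|N] IH] _; first by rewrite expr1 mul1r.
  have h := IH isT; rewrite (exprS _ N.+1).
  have h2 : (N.+2%:R : R) <= 2 * N.+1%:R by rewrite -natrM ler_nat mul2n doubleS !ltnS -addnn leq_addl.
  have p0 : 0 <= (4 / 39) ^+ N.+1 :> R by apply: exprn_ge0; lra.
  have := ler_wpM2r p0 h2; move: h; set p := _ ^+ N.+1; lra.
rewrite ler_pdivlMr // mulrDl.
have e1 : (2 / 39) ^+ N = (4 / 39) ^+ N * (2^-1) ^+ N :> R.
  by rewrite -exprMn; congr (_ ^+ _); field.
have e2 : 4^-1 ^+ N.+1 = 4^-1 * ((2^-1) ^+ N * (2^-1) ^+ N) :> R.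
  by rewrite exprS -exprMn; congr (_ * _ ^+ _); field.
have hm : (2^-1) ^+ N * m%:R <= 1 :> R.
  by rewrite exprVn mulrC ler_pdivrMr ?exprn_gt0 // mul1r.
have h0 : 0 <= (2^-1) ^+ N * m%:R :> R.
  by rewrite mulr_ge0 // exprn_ge0 // invr_ge0.
rewrite e1 e2; set a := 2^-1 ^+ N in hm h0 *; set b := (4 / 39) ^+ N in hN *.
have -> : 12 * N%:R * (b * a) * m%:R = 12 * ((N%:R * b) * (a * m%:R)) by ring.
have -> : m%:R * (4^-1 * (a * a)) * m%:R = 4^-1 * ((a * m%:R) * (a * m%:R)) by ring.
have b0 : 0 <= N%:R * b by rewrite mulr_ge0 // exprn_ge0 //; lra.
have t1 := ler_pM b0 h0 hN hm; have t2 := ler_pM h0 h0 hm hm; lra.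
Qed.

(** In the application b = 40 * 192, L = log n, u = log m, M is their maximum, p is the number of
    phases, and F, C, S are the facility, connection and latency parts of the LP value. The leading
    4 inverts the success probability; 148 = 2 * 74 combines the doubled tree edges with the waiting
    constant. *)
Lemma cost_constants (R : realType) (b L u M p K eps E F C S : R) :
  1 <= b -> 1 <= L -> 1 <= u -> L <= M -> u <= M -> p <= 24 * u -> 0 <= K ->
  0 <= eps <= E -> 0 <= F -> 0 <= C -> 0 <= S ->
  4 * (p * (b * L * F) + 4 * C + 2 * (b * L * (K * L)) * ((2 + eps) * (74 * S))) <=
  4 * (b * (24 + 148 * K * (2 + E))) * (L * M) * (F + C + S).
Proof.
move=> b1 L1 u1 LM uM pu K0 /andP[e0 eE] F0 C0 S0.
have b0 : 0 <= b by lra.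
have L0 : 0 <= L by lra.
have M1 : 1 <= M by lra.
have M0 : 0 <= M by lra.
have E2 : 0 <= 2 + E by lra.
have bLF : 0 <= b * L * F by rewrite !mulr_ge0.
have h1 : p * (b * L * F) <= b * L * M * F * 24.
  apply: le_trans (ler_wpM2r bLF pu) _.
  by have := ler_wpM2r bLF uM; lra.
have h2 : C <= b * L * M * C.
  rewrite ler_peMl // -[1]mul1r ler_pM //.
  by rewrite -[1]mul1r ler_pM.
have h3 : (b * K * L * S) * (L * (2 + eps)) <= (b * K * L * S) * (M * (2 + E)).
  by apply: ler_wpM2l; [rewrite !mulr_ge0|apply: ler_pM; lra].
have z1 : 0 <= b * K * (2 + E) * (L * M * F) by rewrite !mulr_ge0.
have z2 : 0 <= b * K * (2 + E) * (L * M * C) by rewrite !mulr_ge0.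
have z3 : 0 <= b * L * M * S by rewrite !mulr_ge0.
have z4 : 0 <= b * L * M * C by rewrite !mulr_ge0.
move: h1 h2 h3 z1 z2 z3 z4; lra.
Qed.

(** * Tours and arrival times *)

Lemma sum_seq_count (R : realType) (T : finType) (s : seq T) (F : T -> R) :
  \sum_(x <- s) F x = \sum_x (count_mem x s)%:R * F x.
Proof.
elim: s => [|y s IH]; first by rewrite big_nil big1 // => x _; rewrite mul0r.
rewrite big_cons IH; under [RHS]eq_bigr do rewrite /= natrD mulrDl.
rewrite big_split /= [X in _ = X + _](bigD1 y) //= eqxx mul1r [X in _ = _ + X + _]big1 ?addr0 //.
by move=> x /negbTE; rewrite eq_sym => ->; rewrite mul0r.
Qed.

Lemma first_visits_cat (V : eqType) (s1 s2 : seq V) :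
  exists s, first_visits (s1 ++ s2) = first_visits s1 ++ s.
Proof.
rewrite /first_visits rev_cat undup_cat rev_cat.
by eexists; reflexivity.
Qed.

Lemma mem_first_visits (V : eqType) (s : seq V) : first_visits s =i s.
Proof. by move=> x; rewrite mem_rev mem_undup mem_rev. Qed.

Lemma first_visits_subseq (V : eqType) (s : seq V) : subseq (first_visits s) s.
Proof. by rewrite /first_visits -subseq_rev revK undup_subseq. Qed.

Lemma rwalk_cat (R : realType) (V : Type) (delta : V -> V -> R) x p q :
  rwalk delta x (p ++ q) = rwalk delta x p + rwalk delta (last x p) q.
Proof. by rewrite /rwalk pairmap_cat big_cat. Qed.

Lemma rwalk_map (R : realType) (V W : Type) (h : V -> W) (delta : W -> W -> R) x p :
  rwalk delta (h x) (map h p) = rwalk (fun a b => delta (h a) (h b)) x p.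
Proof. by elim: p x => [|y p IH] x; rewrite /rwalk /= ?big_nil // !big_cons -/(rwalk _ _ _) IH. Qed.

Lemma rwalk_le (R : realType) (V : Type) (d1 d2 : V -> V -> R) x p :
  (forall a b, d1 a b <= d2 a b) -> rwalk d1 x p <= rwalk d2 x p.
Proof.
move=> h; elim: p x => [|y p IH] x; rewrite /rwalk /= ?big_nil // !big_cons.
by apply: lerD => //; exact: IH.
Qed.

Lemma walk_lengthE (R : realType) (V : Type) (d : V -> V -> nat) x p :
  (walk_length d x p)%:R = rwalk (fun a b => (d a b)%:R : R) x p.
Proof.
rewrite /walk_length /rwalk; elim: p x => [|y p IH] x /=; first by rewrite big_nil.
by rewrite big_cons natrD IH.
Qed.

Section EulerianTour.

Variables (R : realType) (n : nat) (T : wtree R n) (d : node n -> node n -> nat).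
Local Notation leaf := (@wleaf R n T).
Hypotheses (hT : is_tree T) (hinj : injective leaf).
Hypothesis len_ge0 : forall e, e \in edges T -> 0 <= wlen e.
Hypothesis hd : forall u v, (d u v)%:R <= tree_dist (leaf u) (leaf v).

(** The Eulerian walk weighs twice A, and tree distances dominate d, so shortcutting keeps the
    bound. The return to the root is included so that tours can be chained. *)
Lemma tour_length (A : {set {set T}}) (p : seq T) (tour : seq 'I_n) :
  A \subset edges T -> eulerian_tour_doubled (leaf None) A p ->
  subseq [seq leaf (Some i) | i <- tour] (leaf None :: p) ->
  rwalk (fun a b => (d a b)%:R : R) None (rcons (map some tour) None) <=
  2 * \sum_(e in A) wlen e.
Proof.
move=> /subsetP AE /and3P[pA /eqP pl /forall_inP pc] sub.
have [sT _ _] := hT.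
have hp : path (@adj T) (leaf None) p.
  by apply: sub_path pA => a b /AE; rewrite edges_adj.
(* The root is no facility, so the head of the walk matches nothing in the tour. *)
have sub' : subseq [seq leaf (Some i) | i <- tour] p.
  case: tour sub => [|i tour] /=; first by rewrite sub0seq.
  by case: eqVneq => // /hinj.
have h1 : \sum_(e <- walk_edges (leaf None) p) wlen e = 2 * \sum_(e in A) wlen e.
  rewrite sum_seq_count mulr_sumr [RHS]big_mkcond; apply: eq_bigr => e _.
  case: (boolP (e \in A)) => [eA|eA]; first by rewrite (eqP (pc e eA)).
  rewrite (count_memPn _) ?mul0r //; apply: contra eA => ew.
  by move: pA; rewrite path_edge_rel => /allP /(_ e ew).
have h2 : rwalk (@tree_dist R n T) (leaf None) p <= \sum_(e <- walk_edges (leaf None) p) wlen e.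
  elim: (p) (leaf None) hp => [|y q IH] x /=; first by rewrite /rwalk /= !big_nil.
  move=> /andP[xy hq]; rewrite /rwalk /= !big_cons; apply: lerD; last exact: IH.
  exact: tree_dist_adj.
rewrite -h1; apply: le_trans h2.
apply: le_trans (subseq_walk (leaf None) _ _ sub'); last 2 first.
- exact: tree_dist_refl.
- exact: tree_dist_triangle.
rewrite -cats1 rwalk_cat; apply: lerD.
  rewrite (map_comp leaf some) rwalk_map; exact: rwalk_le.
rewrite /rwalk /= big_seq1 pl (map_comp leaf some) last_map.
exact: hd.
Qed.

End EulerianTour.

Lemma rwalk_rounds (R : realType) (L V : eqType) (delta : V -> V -> R) (r : V)
    (tour : L -> seq V) (ls : seq L) :
  rwalk delta r (flatten [seq rcons (tour l) r | l <- ls]) =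
  \sum_(l <- ls) rwalk delta r (rcons (tour l) r).
Proof.
elim: ls => [|l ls IH]; first by rewrite /rwalk !big_nil.
by rewrite big_cons /= rwalk_cat last_rcons IH.
Qed.

Lemma subseq_flatten_rcons (L V : eqType) (r : V) (tour : L -> seq V) (ls : seq L) :
  subseq (flatten [seq tour l | l <- ls]) (flatten [seq rcons (tour l) r | l <- ls]).
Proof.
elim: ls => [|l ls IH] //=; apply: cat_subseq => //; exact: subseq_rcons.
Qed.

(* Returning to the root after every tour can only delay the visits. *)
Lemma arrival_le (R : realType) (n N : nat) (d : node n -> node n -> nat)
    (tour : 'I_N -> seq 'I_n) (i : 'I_n) (l : 'I_N) :
  is_metric d -> i \in tour l ->
  (arrival d (first_visits (flatten [seq tour l | l <- enum 'I_N])) i)%:R <=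
  \sum_(l' : 'I_N | (l' <= l)%N)
     rwalk (fun a b => (d a b)%:R : R) None (rcons (map some (tour l')) None).
Proof.
move=> [d0 _ dt] il; set ls := take l.+1 (enum 'I_N).
have lsE l' : (l' \in ls) = (l' <= l)%N.
  by rewrite in_take ?mem_enum // index_enum_ord ltnS.
have -> : enum 'I_N = ls ++ drop l.+1 (enum 'I_N) by rewrite cat_take_drop.
rewrite map_cat flatten_cat; set s1 := flatten _; set s2 := flatten _.
have is1 : i \in s1.
  by apply/flattenP; exists (tour l) => //; apply: map_f; rewrite lsE.
(* First visits of a concatenation begin with those of its first part, so the tours after l do not
   affect the arrival at i. *)
have [q ->] := first_visits_cat s1 s2.
rewrite /arrival walk_lengthE index_cat mem_first_visits is1.
rewrite takel_cat; last by rewrite index_mem mem_first_visits.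
set pre := take _ _.
have sub : subseq (map some pre) (flatten [seq rcons (map some (tour l)) None | l <- ls]).
  apply: (subseq_trans _ (subseq_flatten_rcons None (fun l => map some (tour l)) ls)).
  have -> : flatten [seq map some (tour l) | l <- ls] = map some s1.
    by rewrite map_flatten -map_comp.
  apply: map_subseq; apply: subseq_trans (first_visits_subseq s1).
  exact: take_subseq.
pose delta := fun a b : node n => (d a b)%:R : R.
have dd0 u : delta u u = 0 by rewrite /delta (eqP (_ : d u u == 0%N)) // d0.
have ddt u v x : delta u x <= delta u v + delta v x by rewrite /delta -natrD ler_nat.
have := subseq_walk (None : node n) dd0 ddt sub.
rewrite rwalk_rounds => h.
have -> : \sum_(l' : 'I_N | (l' <= l)%N) rwalk delta None (rcons (map some (tour l')) None) =
  \sum_(l' <- ls) rwalk delta None (rcons (map some (tour l')) None).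
  rewrite [RHS]big_uniq ?take_uniq ?enum_uniq //.
  by apply: eq_bigl => l'; rewrite lsE.
apply: le_trans h; by rewrite lerDl ler0n.
Qed.

Lemma sum_dffun_prod_event (R : realType) (J : finType) (T_ : J -> finType)
    (F : forall i, T_ i -> R) (G : forall i, pred (T_ i)) :
  \sum_(w : {dffun forall i, T_ i} | [forall i, G i (w i)]) \prod_i F i (w i) =
  \prod_i \sum_(x : T_ i | G i x) F i x.
Proof.
rewrite (eq_bigr (fun i => \sum_(x : T_ i) if G i x then F i x else 0)); last first.
  by move=> i _; rewrite big_mkcond.
rewrite -(sum_dffun_prod (fun i x => if G i x then F i x else 0)).
rewrite big_mkcond; apply: eq_bigr => w _; case: ifPn => [/forallP h|].
  by apply: eq_bigr => i _; rewrite h.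
by rewrite negb_forall => /existsP[i /negbTE h]; rewrite (bigD1 i) //= h mul0r.
Qed.

(** * The whole run *)

Section Run.

Variables (R : realType) (K0 : R) (TE : embedding_algorithm R) (GKR : gkr_algorithm R).
Hypotheses (hTE : tree_embedding_guarantee K0 TE) (hGKR : gkr_guarantee GKR).
Variables (n m : nat) (I : instance R n m) (eps : R) (k : nat) (s : lpsol R n m).
Hypotheses (n1 : (1 < n)%N) (m1 : (1 < m)%N) (eps_gt0 : 0 < eps).
Hypothesis hs : lp_feasible I (TS eps k) s.
Variable sel : selection_rule I eps k s.
Hypothesis hsel : valid_rule sel.

Local Notation phase := (phase I eps k s).
Local Notation ts := (TS eps k).
Local Notation outcome := (outcome TE I eps k s).

Section AtPhase.

Variable l : phase.
Local Notation T := (ptree TE l).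
Local Notation leaf := (@wleaf R n T).
Local Notation z := (fun g => lz s g (ptime l)).

Lemma ptime_TS : ptime l \in ts.
Proof. exact: TS_at_in. Qed.

Lemma z_ge0 g : g \in complete_edges n -> 0 <= z g.
Proof. by move=> gE; exact: (lp_z_ge0 hs gE ptime_TS). Qed.

Lemma ptree_tree : is_tree T.
Proof. by have [] := hTE n1 (dist_metric I) z_ge0. Qed.

Lemma ptree_inj : injective leaf.
Proof. by have [_ []] := hTE n1 (dist_metric I) z_ge0. Qed.

Lemma ptree_leaf (v : T) : (degree v == 1%N) = (v \in codom leaf).
Proof. by have [_ [_ [h _]]] := hTE n1 (dist_metric I) z_ge0; exact: h. Qed.

Lemma ptree_len_ge0 (e : {set T}) : e \in edges T -> 0 <= wlen e.
Proof. by have [_ [_ [_ [h _]]]] := hTE n1 (dist_metric I) z_ge0; exact: h. Qed.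

Lemma ptree_dist u v : (dist I u v)%:R <= tree_dist (leaf u) (leaf v).
Proof. by have [_ [_ [_ [_ [h _]]]]] := hTE n1 (dist_metric I) z_ge0; exact: h. Qed.

Lemma dummy_weight_ge0 i : 0 <= dummy_weight l i.
Proof.
rewrite /dummy_weight big_seq_cond; apply: sumr_ge0 => t /andP[tts _].
exact: (lp_y_ge0 hs).
Qed.

Lemma core_weight_ge0 (e : {set T}) : 0 <= core_weight e.
Proof. exact: (routed_ge0 z_ge0 e). Qed.

Lemma ext_weight_dummy i : ext_weight (dummy_edge T i) = dummy_weight l i.
Proof.
rewrite /ext_weight; case: pickP => [i' /eqP /dummy_edge_inj -> //|/(_ i)].
by rewrite eqxx.
Qed.

Lemma ext_weight_core (e : {set T}) :
  @ext_weight R TE n m I eps k s l (ext_edge e) = core_weight e.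
Proof.
rewrite /ext_weight; case: pickP => [i|_].
  by rewrite (negbTE (ext_edge_neq_dummy _ _)).
by rewrite ext_edgeK.
Qed.

(** The LP length constraint at [ptime l] turns the embedding guarantee into a multiple of the phase
    time. The sign of [K0] is unknown, hence the absolute value. *)
Lemma tree_budget :
  \sum_(e in edges T) wlen e * core_weight e <= `|K0| * log2 n%:R * (ptime l)%:R.
Proof.
have [_ [_ [_ [_ [_ h]]]]] := hTE n1 (dist_metric I) z_ge0.
rewrite (routed_length z ptree_tree); apply: le_trans h _.
have l0 : 0 <= log2 (n%:R : R) by apply: le_trans (log2_ge1 R n1).
rewrite -mulrA -[leRHS]mulrA; apply: le_trans (ler_wpM2r _ (ler_norm K0)) _.
  apply: mulr_ge0 => //.
  by apply: sumr_ge0 => g gE; rewrite mulr_ge0 // z_ge0.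
rewrite !ler_wpM2l //.
exact: (lp_length hs ptime_TS).
Qed.

Lemma facility_budget :
  \sum_i fcost I i * dummy_weight l i <= \sum_i \sum_(t <- ts) fcost I i * ly s i t.
Proof.
apply: ler_sum => i _; rewrite -mulr_sumr ler_wpM2l ?fcost_ge0 //.
rewrite /dummy_weight big_mkcond big_seq [leRHS]big_seq; apply: ler_sum => t tts.
by case: ifP => // _; exact: (lp_y_ge0 hs).
Qed.

Lemma gkr_facts :
  [/\ forall A, 0 <= @gkr_law R TE GKR n m I eps k s l A,
      \sum_A @gkr_law R TE GKR n m I eps k s l A = 1,
      forall A, 0 < @gkr_law R TE GKR n m I eps k s l A -> rooted_subtree (ext_node (leaf None)) A,
      forall e, e \in edges (ext_graph T) ->
        \sum_(A : {set {set ext_graph T}} | e \in A) @gkr_law R TE GKR n m I eps k s l A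
          <= ext_weight e &
      forall j, (tau I eps k s j <= ptime l)%N ->
        \sum_(A : {set {set ext_graph T}} | [disjoint subnodes (ext_node (leaf None)) A &
            [set dummy_node T i | i in nbh I eps k s j]]) @gkr_law R TE GKR n m I eps k s l A
          <= expR (- (2 / 3 / (64 * log2 n%:R)))].
Proof.
have hcard := card_rooted_leaves_ext ptree_leaf.
have hW e : e \in edges (ext_graph T) -> 0 <= ext_weight e.
  exact: (extended_weight_ge0 z_ge0 dummy_weight_ge0 ext_weight_dummy ext_weight_core).
have [|a|||a S gS rS|] := @hGKR (pext TE l) (proot TE l) _ (@pgroup R TE n m I eps k s l)
  (@ext_weight R TE n m I eps k s l) (fun _ => 2 / 3) (ext_is_tree ptree_tree).
- by rewrite [X in (_ < X)%N]hcard.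
- have -> : rooted_leaves (proot TE l) = _ := rooted_leaves_ext ptree_leaf.
  by apply/subsetP => x /imsetP[i _ ->]; apply: imset_f.
- exact: hW.
- by move=> _; lra.
- set j := enum_val a in gS.
  have jt : (tau I eps k s j <= ptime l)%N.
    by have := enum_valP a; rewrite inE.
  apply: le_trans (massP eps_gt0 hs jt) _.
  have hcut := ext_cut_weight ptree_tree z_ge0 dummy_weight_ge0 ext_weight_dummy ext_weight_core rS.
  apply: le_trans hcut.
  (* The mass in N_j splits by the position of leaf i: outside S, x <= y is paid by the cut dummy
     edge; inside S, the LP cut constraint applies. *)
  rewrite /mass (bigID (fun i => ext_node (leaf (Some i)) \notin S)) /=; apply: lerD.
    rewrite [leLHS]big_mkcond [leRHS]big_mkcond; apply: ler_sum => i _ /=.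
    case: (boolP (i \in nbh I eps k s j)) => inb /=; last first.
      by case: ifP => // _; exact: dummy_weight_ge0.
    have -> : dummy_node T i \in S.
      by apply: (subsetP gS); apply/imsetP; exists i.
    case: ifP => //= _; rewrite /dummy_weight big_seq_cond [leRHS]big_seq_cond.
    by apply: ler_sum => t /andP[tts _]; exact: (lp_open hs).
  apply: le_trans (lp_cut hs _ j ptime_TS).
  rewrite [leLHS]big_mkcond [leRHS]big_mkcond; apply: ler_sum => i _ /=.
  have -> : (i \in [set i | ext_node (leaf (Some i)) \in S]) =
    (ext_node (leaf (Some i)) \in S) by rewrite inE.
  rewrite negbK; have x0 := sum_x_ge0 hs i j (fun t => (t <= ptime l)%N).
  by case: (i \in nbh I eps k s j) => /=; case: ifP.
move=> law0 [law1 [supp [edge cover]]]; split => // j jt.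
have jD : j \in pclients l by rewrite inE.
have := cover (enum_rank_in jD j); rewrite /pgroup enum_rankK_in //.
have -> : #|rooted_leaves (proot TE l)| = n by exact: hcard.
exact.
Qed.

Definition phase_result : finType :=
  {ffun 'I_(num_trees R m) * 'I_(num_exec R n) -> {set {set pext TE l}}}.

Definition phase_law (v : phase_result) : R := \prod_qe gkr_law GKR (v qe).

Definition good_trials (v : phase_result) : {set 'I_(num_trees R m)} :=
  @phase_good R n T (fcost I) (dummy_weight l) (@core_weight R TE n m I eps k s l) _ v.

Definition opened (v : phase_result) : {set 'I_n} :=
  reached (phase_trial v (sel l (good_trials v))).

Lemma phase_law_ge0 v : 0 <= phase_law v.
Proof. by apply: prodr_ge0 => qe _; have [h _ _ _ _] := gkr_facts. Qed.

Lemma phase_law1 : \sum_v phase_law v = 1.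
Proof. by have [_ h _ _ _] := gkr_facts; exact: (sum_ffun_prod1 _ h). Qed.

Lemma phase_fails : \sum_(v | good_trials v == set0) phase_law v <= (2 / 39) ^+ num_trees R m.
Proof.
have [h0 h1 _ hedge _] := gkr_facts.
exact: (phase_no_good n1 ptree_len_ge0 (@fcost_ge0 _ _ _ I) dummy_weight_ge0 core_weight_ge0
  ext_weight_dummy ext_weight_core h0 h1 hedge (num_trees R m)).
Qed.

Lemma phase_misses j : (tau I eps k s j <= ptime l)%N ->
  \sum_(v | (good_trials v != set0) && (nbh I eps k s j :&: opened v == set0)) phase_law v
    <= 4^-1.
Proof.
move=> jt; have [h0 h1 hsupp hedge hcov] := gkr_facts.
exact: (phase_uncovered n1 ptree_tree ptree_inj ptree_leaf ptree_len_ge0 (@fcost_ge0 _ _ _ I)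
  dummy_weight_ge0 core_weight_ge0 ext_weight_dummy ext_weight_core h0 h1 hsupp hedge
  (hsel l) (hcov j jt)).
Qed.

End AtPhase.

Local Notation tau := (tau I eps k s).
Local Notation Lbar := (Lbar eps k s).
Local Notation last := (last_phase I eps k s).
Local Notation nbh := (nbh I eps k s).

Lemma probE (w : outcome) : prob GKR w = \prod_(l : phase) phase_law (w l).
Proof. by []. Qed.

Lemma prob_ge0 (w : outcome) : 0 <= prob GKR w.
Proof. by rewrite probE; apply: prodr_ge0 => l _; exact: phase_law_ge0. Qed.

(** Independence of the phases. An event about some phases only is expressed by making the condition
    trivial on the others. *)
Lemma prob_events (G : forall l : phase, pred (phase_result l)) :
  \sum_(w : outcome | [forall l, G l (w l)]) prob GKR w =
  \prod_(l : phase) \sum_(v | G l v) phase_law v.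
Proof. exact: (sum_dffun_prod_event (fun l => @phase_law l)). Qed.

Lemma prob_total : \sum_(w : outcome) prob GKR w = 1.
Proof.
rewrite (eq_bigl (fun w : outcome => [forall l : phase, (fun l => predT) l (w l)])).
  rewrite (prob_events (fun l => predT)) big1 // => l _; exact: phase_law1.
by move=> w; apply/esym/forallP.
Qed.

Lemma prob_phase_fails (l : phase) :
  \sum_(w : outcome | good w l == set0) prob GKR w <= (2 / 39) ^+ num_trees R m.
Proof.
rewrite (eq_bigl (fun w : outcome => [forall l' : phase,
   (l' == l) ==> (good_trials (w l') == set0)])); last first.
  move=> w; apply/idP/forallP => [h l'|/(_ l)]; last by rewrite eqxx.
  by apply/implyP => /eqP ->.
rewrite (prob_events (fun l' v => (l' == l) ==> (good_trials v == set0))).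
rewrite (bigD1 l) //= eqxx [X in _ * X]big1 ?mulr1 => [|l' /negbTE -> /=].
  exact: phase_fails.
exact: phase_law1.
Qed.

(* All phases before b pick a tree, and none of them connects j. *)
Definition missed (j : 'I_m) (b : nat) (w : outcome) : bool :=
  [forall l : phase, (l < b)%N ==> (good w l != set0) && (nbh j :&: popen sel w l == set0)].

Definition miss_prob (j : 'I_m) (b : nat) : R := \sum_(w | missed j b w) prob GKR w.

Let pmiss (j : 'I_m) (l : phase) : R :=
  \sum_(v : phase_result l | (good_trials v != set0) && (nbh j :&: opened v == set0)) phase_law v.

Lemma miss_probE j b : miss_prob j b = \prod_(l : phase | (l < b)%N) pmiss j l.
Proof.
rewrite /miss_prob /missed (prob_events (fun l v => (l < b)%N ==>
  (good_trials v != set0) && (nbh j :&: opened v == set0))).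
rewrite [RHS]big_mkcond; apply: eq_bigr => l _; case: ifP => _ //=.
exact: phase_law1.
Qed.

Lemma pmiss_ge0 j l : 0 <= pmiss j l.
Proof. by apply: sumr_ge0 => v _; exact: phase_law_ge0. Qed.

Lemma pmiss_le1 j l : pmiss j l <= 1.
Proof.
rewrite -(phase_law1 l) /pmiss big_mkcond; apply: ler_sum => v _.
by case: ifP => // _; exact: phase_law_ge0.
Qed.

Lemma miss_prob01 j b : 0 <= miss_prob j b <= 1.
Proof.
rewrite miss_probE; apply/andP; split; first by apply: prodr_ge0 => l _; exact: pmiss_ge0.
by apply: prodr_ile1 => l _; rewrite pmiss_ge0 pmiss_le1.
Qed.

Lemma miss_probS j (l : phase) : miss_prob j l.+1 = pmiss j l * miss_prob j l.
Proof.
rewrite !miss_probE (bigD1 l) //=; congr (_ * _); apply: eq_bigl => l'.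
by rewrite ltnS andbC [RHS]ltn_neqAle.
Qed.

Lemma Lbar_ge1 : 1 <= Lbar.
Proof.
rewrite /Lbar ler_pdivlMr ?ltr0n ?(ltnW m1) // mul1r.
rewrite -[X in X%:R]card_ord -sum1_card natr_sum; apply: ler_sum => j _.
exact: (Lstar_ge1 eps_gt0 hs).
Qed.

Lemma sum_Lstar : \sum_j Lstar eps k s j = m%:R * Lbar.
Proof. by rewrite /Lbar mulrC divfK // pnatr_eq0 -lt0n ltnW. Qed.

(** Past T_k the phase time is truncated to T_k, which still dominates tau because tau lies in
    TS. *)
Lemma ptime_ge_tau j (l : phase) : (tau j)%:R <= Lbar * 2 ^+ l -> (tau j <= ptime l)%N.
Proof.
move=> h; have [hk|hk] := leP (Lbar * 2 ^+ l) (Tq eps k)%:R.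
  by rewrite -(@ler_nat R); apply: le_trans h _; exact: TS_at_ge.
rewrite /ptime TS_at_big ?(ltW hk) //.
exact: (TS_le eps_gt0 (tau_TS I eps k s j)).
Qed.

Lemma ptime_le (l : phase) : (ptime l)%:R <= (2 + eps) * (Lbar * 2 ^+ l).
Proof.
apply: TS_at_le => //; have h1 := Lbar_ge1; have : 1 <= 2 ^+ l :> R by apply: exprn_ege1; lra.
move=> h2; have := ler_pM ler01 ler01 h1 h2; lra.
Qed.

Lemma miss_prob_quarter j b : (b < last.+1)%N -> (tau j)%:R <= Lbar * 2 ^+ b ->
  miss_prob j b.+1 <= miss_prob j b / 4.
Proof.
move=> bl h; pose l : phase := Ordinal bl.
rewrite (miss_probS j l) mulrC ler_wpM2l //; first by case/andP: (miss_prob01 j l).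
by apply: phase_misses; exact: (@ptime_ge_tau j l).
Qed.

Lemma expected_wait j :
  \sum_(l : phase) (ptime l)%:R * miss_prob j l <= (2 + eps) * (6 * (tau j)%:R + 2 * Lbar).
Proof.
have e0 := eps_gt0; have L1 := Lbar_ge1.
apply: (@le_trans _ _ ((2 + eps) * \sum_(b < last.+1) Lbar * 2 ^+ b * miss_prob j b)).
  rewrite mulr_sumr; apply: ler_sum => l _; rewrite [leRHS]mulrA ler_wpM2r ?ptime_le //.
  by case/andP: (miss_prob01 j l).
apply: ler_wpM2l; first by lra.
apply: geometric_phases => [||b|b bl].
- exact: le_trans ler01 L1.
- exact: ler0n.
- exact: miss_prob01.
- by apply: miss_prob_quarter; exact: ltnW.
Qed.

(** * Number of phases and probability of failure *)

Let u : R := log2 m%:R.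
Let N := num_trees R m.

Lemma num_trees_bounds : u <= N%:R /\ N%:R < u + 1.
Proof.
have u1 : 1 <= u by exact: log2_ge1.
by split; [exact: ceiln_ge|apply: ceiln_lt; exact: le_trans ler01 u1].
Qed.

Lemma m_le_pow_num_trees : (m%:R : R) <= 2 ^+ N.
Proof.
by apply: log2_le_pow; [rewrite ltr0n ltnW|case: num_trees_bounds].
Qed.

Lemma taumax_le j : (tau j <= taumax I eps k s)%N.
Proof. exact: leq_bigmax. Qed.

Lemma taumax_gt0 : (0 < taumax I eps k s)%N.
Proof.
apply: leq_trans (taumax_le (Ordinal (ltnW m1))).
exact: (TS_gt0 eps_gt0 (tau_TS I eps k s _)).
Qed.

Lemma taumax_Lbar : (taumax I eps k s)%:R <= 12 * (m%:R * Lbar).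
Proof.
have [j ->] : exists j, taumax I eps k s = tau j.
  have m0 : (0 < #|'I_m|)%N by rewrite card_ord ltnW.
  by have [j hj] := bigop.eq_bigmax (fun j => tau j) m0; exists j.
rewrite -sum_Lstar; apply: le_trans (tau_Lstar hs j) _.
rewrite ler_wpM2l // (bigD1 j) //= lerDl; apply: sumr_ge0 => j' _.
by apply: le_trans ler01 (Lstar_ge1 eps_gt0 hs j').
Qed.

Let X : R := Num.max 0 (log2 (2 * (taumax I eps k s)%:R / Lbar)).

(** 2 taumax / Lbar <= 24 m <= 2^5 m. *)
Lemma log_ratio_le : X <= 5 + u.
Proof.
have u1 : 1 <= u by exact: log2_ge1.
have L1 := Lbar_ge1; have t0 : 0 < (taumax I eps k s)%:R :> R by rewrite ltr0n taumax_gt0.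
have mp : 0 < (m%:R : R) by rewrite ltr0n ltnW.
rewrite ge_max; apply/andP; split; first by lra.
rewrite -[5](log2_pow R 5) -log2M ?exprn_gt0 //; apply: ler_log2.
  by rewrite divr_gt0 //; lra.
rewrite ler_pdivrMr; last by lra.
have := taumax_Lbar; have : 0 <= m%:R * Lbar by rewrite mulr_ge0 //; lra.
lra.
Qed.

(** The count is below X + 4u + 2 <= 5u + 7 <= 12u, as u >= 1. *)
Lemma num_phases : last.+1%:R <= 12 * (N%:R : R).
Proof.
have u1 : 1 <= u by exact: log2_ge1.
have [N1 _] := num_trees_bounds; have Xle := log_ratio_le.
have X0 : 0 <= X by rewrite le_max lexx.
have := @ceiln_lt R (X + 4 * u); rewrite -/(last_phase _ _ _ _) -[last.+1%:R]natr1.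
by move=> h; have {}h : last%:R < X + 4 * u + 1 by [apply: h; lra]; lra.
Qed.

(** From phase a = ceil X on, the nominal length is at least every tau. At least N + 1 phases
    remain, because a + N < X + u + 2 <= X + 4u, and each is missed with probability at most 1/4. *)
Lemma unconnected_prob j : miss_prob j last.+1 <= 4^-1 ^+ N.+1.
Proof.
have u1 : 1 <= u by exact: log2_ge1.
have [_ N1] := num_trees_bounds; have L1 := Lbar_ge1.
have X0 : 0 <= X by rewrite le_max lexx.
have [a Xa aX] : exists2 a, X <= a%:R & a%:R < X + 1.
  by exists (ceiln X); [exact: ceiln_ge|exact: ceiln_lt].
have aN : (a + N <= last)%N.
  rewrite -(@ler_nat R) natrD; apply: le_trans (ceiln_ge _); rewrite -/X -/u.
  lra.
have ha b : (a <= b)%N -> (tau j)%:R <= Lbar * 2 ^+ b.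
  move=> ab; have t0 : 0 < (taumax I eps k s)%:R :> R by rewrite ltr0n taumax_gt0.
  have : 2 * (taumax I eps k s)%:R / Lbar <= 2 ^+ a.
    apply: log2_le_pow; first by rewrite divr_gt0 //; lra.
    by apply: le_trans Xa; rewrite le_max lexx orbT.
  rewrite ler_pdivrMr; last by lra.
  have : 2 ^+ a <= 2 ^+ b :> R by rewrite ler_weXn2l //; lra.
  move=> h1 h2; have := ler_wpM2r (le_trans ler01 L1) h1.
  have : (tau j)%:R <= (taumax I eps k s)%:R :> R by rewrite ler_nat taumax_le.
  lra.
have hp c : (a + c <= last.+1)%N -> miss_prob j (a + c) <= 4^-1 ^+ c.
  elim: c => [_|c IH hc]; first by rewrite expr0; case/andP: (miss_prob01 j (a + 0)).
  rewrite addnS in hc *; apply: le_trans (miss_prob_quarter hc (ha _ (leq_addr _ _))) _.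
  by rewrite exprS mulrC ler_wpM2l ?invr_ge0 // IH // ltnW.
have mono b c : (b + c <= last.+1)%N -> miss_prob j (b + c) <= miss_prob j b.
  elim: c => [_|c IH hc]; first by rewrite addn0.
  rewrite addnS in hc *; apply: le_trans (IH (ltnW hc)).
  rewrite (miss_probS j (Ordinal hc)) ler_piMl ?pmiss_le1 //.
  by case/andP: (miss_prob01 j (b + c)).
have aN1 : (a + N.+1 <= last.+1)%N by rewrite addnS.
apply: le_trans (hp _ aN1); rewrite -[in leLHS](subnKC aN1).
by apply: mono; rewrite subnKC.
Qed.

(** A failed run either has a phase without a good tree, or has good trees throughout and a client
    missed by all phases: a union bound over phases and clients. *)
Lemma failure_bound : prob_failure TE GKR sel <= (3 / 2) / m%:R ^+ 1.
Proof.
rewrite expr1.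
have [uN N1] := num_trees_bounds; have u1 : 1 <= u by exact: log2_ge1.
have N0 : (0 < N)%N by rewrite -(@ltr_nat R); lra.
apply: le_trans (phase_failure_sum N0 m_le_pow_num_trees (ltnW m1)).
apply: (@le_trans _ _ (\sum_(l : phase) \sum_(w : outcome | good w l == set0) prob GKR w +
   \sum_j miss_prob j last.+1)); last first.
  apply: lerD.
    apply: (@le_trans _ _ (\sum_(l : phase) (2 / 39) ^+ N)).
      by apply: ler_sum => l _; exact: prob_phase_fails.
    rewrite sumr_const card_ord -[leLHS]mulr_natl ler_wpM2r ?num_phases //.
    by apply: exprn_ge0; lra.
  apply: (@le_trans _ _ (\sum_(j < m) 4^-1 ^+ N.+1)).
    by apply: ler_sum => j _; exact: unconnected_prob.
  by rewrite sumr_const card_ord -[leLHS]mulr_natl.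
rewrite /miss_prob.
under eq_bigr do rewrite big_mkcond.
under [X in _ + X]eq_bigr do rewrite big_mkcond.
rewrite exchange_big [X in _ + X]exchange_big -big_split /prob_failure big_mkcond /=.
apply: ler_sum => w _; have p0 := prob_ge0 w.
have s1 : 0 <= \sum_(l : phase) (if good w l == set0 then prob GKR w else 0).
  by apply: sumr_ge0 => l _; case: ifP.
have s2 : 0 <= \sum_j (if missed j last.+1 w then prob GKR w else 0).
  by apply: sumr_ge0 => j _; case: ifP.
case: ifPn => [|_]; last by lra.
rewrite /success negb_and => /orP[].
  rewrite negb_forall => /existsP[l]; rewrite negbK => gl.
  rewrite (bigD1 l) //= gl -addrA lerDl addr_ge0 //.
  by apply: sumr_ge0 => l' _; case: ifP.
have [/existsP[l gl] _|allgood] := boolP [exists l, good w l == set0].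
  rewrite (bigD1 l) //= gl -addrA lerDl addr_ge0 //.
  by apply: sumr_ge0 => l' _; case: ifP.
rewrite negb_forall => /existsP[j]; rewrite negb_exists => /forallP hj.
have mj : missed j last.+1 w.
  apply/forallP => l; rewrite ltn_ord /=; move: (hj l); rewrite negbK => ->.
  by rewrite andbT; move: allgood; rewrite negb_exists => /forallP /(_ l).
rewrite [X in _ + X](bigD1 j) //= mj addrCA lerDl addr_ge0 //.
by apply: sumr_ge0 => j' _; case: ifP.
Qed.

Lemma success_bound : 4^-1 <= prob_success TE GKR sel.
Proof.
have := prob_total; rewrite (bigID (success sel)) /=.
rewrite -/(prob_success TE GKR sel) -/(prob_failure TE GKR sel).
have := failure_bound; rewrite expr1.
have : (3 / 2) / m%:R <= 3 / 4 :> R.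
  have m2 : 2 <= (m%:R : R) by rewrite ler_nat.
  by rewrite ler_pdivrMr; lra.
lra.
Qed.

Local Notation budget := (40 * (192 * log2 n%:R)).

Lemma budget_ge0 : 0 <= budget :> R.
Proof.
have l0 : 0 <= log2 (n%:R : R) by apply: le_trans (log2_ge1 R n1).
by apply: mulr_ge0 => //; exact: mulr_ge0.
Qed.

Local Notation overhead := (2 * (budget * (`|K0| * log2 n%:R))).

Lemma overhead_ge0 : 0 <= overhead.
Proof.
have l0 : 0 <= log2 (n%:R : R) by apply: le_trans (log2_ge1 R n1).
by apply: mulr_ge0 => //; apply: (mulr_ge0 budget_ge0); exact: mulr_ge0.
Qed.

(** * Cost of a successful run *)

Section Success.

Variable w : outcome.
Hypothesis w_ok : success sel w.

Lemma good_nonempty (l : phase) : good w l != set0.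
Proof. by move: w_ok => /andP[/forallP /(_ l)]. Qed.

Lemma selected_good (l : phase) :
  cond_i (cand w l (sel l (good w l))) /\ cond_ii (cand w l (sel l (good w l))).
Proof. by have := hsel l (good_nonempty l); rewrite inE => /andP. Qed.

Lemma popen_cost (l : phase) :
  \sum_(i in popen sel w l) fcost I i <= budget * \sum_i \sum_(t <- ts) fcost I i * ly s i t.
Proof.
have [ci _] := selected_good l.
apply: (@le_trans _ _ (budget * \sum_i fcost I i * dummy_weight l i)); last first.
  by apply: ler_wpM2l; [exact: budget_ge0|exact: facility_budget].
apply: le_trans ci; rewrite big_mkcond [leRHS]big_mkcond /=; apply: ler_sum => i _.
case: (boolP (i \in popen sel w l)) => [|_]; last by case: ifP => // _; exact: fcost_ge0.
rewrite inE => h; have := core_prune_dummy (ptree_inj (l := l)) h.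
by rewrite -/(cand w l (sel l (good w l))) => ->.
Qed.

Lemma chosen_length (l : phase) :
  \sum_(e in chosen sel w l) wlen e <= budget * (`|K0| * log2 n%:R * (ptime l)%:R).
Proof.
have [_ cii] := selected_good l; apply: le_trans cii _.
by apply: ler_wpM2l; [exact: budget_ge0|exact: tree_budget].
Qed.

Variable sol : solution n m.
Hypothesis hsol : returns sel w sol.

Lemma returns_feasible : feasible sol.
Proof.
have [tour ht [ho hr ha]] := hsol; split.
- by rewrite hr rev_uniq undup_uniq.
- move=> i; rewrite hr mem_first_visits ho; apply/flattenP/bigcupP.
    move=> [q /mapP[l _ ->] il]; exists l => //.
    by have [p _ [_ <- _]] := ht l.
  move=> [l _ il]; exists (tour l); first by apply: map_f; rewrite mem_enum.
  by have [p _ [_ -> _]] := ht l.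
- move=> j; have [l [_]] := ha j; rewrite inE ho => /andP[_ jl].
  by apply/bigcupP; exists l.
Qed.

(** [missed j l] concerns only phases strictly before l, so on a successful run it holds up to and
    including the phase that connects j, whose tour must be charged too. *)
Lemma arrival_wait j :
  (arrival (dist I) (sroute sol) (sassign sol j))%:R <=
  overhead *
    \sum_(l : phase) (ptime l)%:R * (missed j l w)%:R.
Proof.
have [tour ht [ho -> ha]] := hsol; have [l [hl]] := ha j.
rewrite inE => /andP[_ jl].
have jt : sassign sol j \in tour l by have [p _ [_ -> _]] := ht l.
apply: le_trans (arrival_le _ (dist_metric I) jt) _.
rewrite mulr_sumr big_mkcond /=; apply: ler_sum => l' _.
have b0 := budget_ge0; have o0 := overhead_ge0.
case: ifP => [ll|_]; last by apply: mulr_ge0 => //; exact: mulr_ge0.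
have -> : missed j l' w.
  apply/forallP => l''; apply/implyP => h.
  by rewrite good_nonempty hl ?eqxx // (leq_trans h).
rewrite mulr1; have [p hp [_ _ sub]] := ht l'.
apply: le_trans (tour_length (ptree_tree l') (ptree_inj (l := l')) (ptree_len_ge0 (l := l'))
  (ptree_dist l') _ hp sub) _.
  by apply/subsetP => e; rewrite inE => /andP[].
rewrite -[leRHS]mulrA; apply: ler_wpM2l => //.
by rewrite -mulrA; exact: chosen_length.
Qed.

Lemma cost_wait :
  cost I sol <= last.+1%:R * (budget * \sum_i \sum_(t <- ts) fcost I i * ly s i t) +
    4 * (\sum_j Cstar I eps k s j) +
    overhead *
      \sum_j \sum_(l : phase) (ptime l)%:R * (missed j l w)%:R.
Proof.
rewrite /cost -addrA; apply: lerD.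
  have [tour ht [-> _ _]] := hsol.
  apply: (@le_trans _ _ (\sum_(l : phase) \sum_(i in popen sel w l) fcost I i)).
    under [leRHS]eq_bigr do rewrite big_mkcond.
    rewrite exchange_big big_mkcond /=; apply: ler_sum => i _.
    have nn (l : phase) : 0 <= (if i \in popen sel w l then fcost I i else 0).
      by case: ifP => // _; exact: fcost_ge0.
    case: bigcupP => [[l _ il]|_]; last exact: sumr_ge0.
    by rewrite (bigD1 l) //= il lerDl sumr_ge0.
  rewrite mulr_natl -[X in _ *+ X]card_ord -sumr_const.
  by apply: ler_sum => l _; exact: popen_cost.
rewrite big_split /= !mulr_sumr; apply: lerD; apply: ler_sum => j _.
  have [tour _ [_ _ /(_ j) [l [_]]]] := hsol.
  by rewrite inE => /andP[]; rewrite inE.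
exact: arrival_wait.
Qed.

End Success.

Lemma sum_missed j :
  \sum_(w : outcome) prob GKR w * (\sum_(l : phase) (ptime l)%:R * (missed j l w)%:R) =
  \sum_(l : phase) (ptime l)%:R * miss_prob j l.
Proof.
under eq_bigr do rewrite mulr_sumr.
rewrite exchange_big; apply: eq_bigr => l _.
rewrite /miss_prob [in RHS]big_mkcond mulr_sumr; apply: eq_bigr => w _.
by rewrite mulrCA; case: (missed j l w); rewrite ?mulr1 ?mulr0.
Qed.

(** 6 tau <= 72 L*, and the m copies of 2 Lbar add 2, since m Lbar is the sum of the L*. *)
Lemma sum_wait :
  \sum_j \sum_(l : phase) (ptime l)%:R * miss_prob j l <=
  (2 + eps) * (74 * \sum_j Lstar eps k s j).
Proof.
have e0 := eps_gt0.
apply: (@le_trans _ _ (\sum_j (2 + eps) * (72 * Lstar eps k s j + 2 * Lbar))).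
  apply: ler_sum => j _; apply: le_trans (expected_wait j) _.
  apply: ler_wpM2l; first by lra.
  by have := tau_Lstar hs j; lra.
rewrite -mulr_sumr; apply: ler_wpM2l; first by lra.
rewrite big_split /= -mulr_sumr sumr_const card_ord sum_Lstar -[_ *+ m]mulr_natl; lra.
Qed.

(** The bound on the cost is nonnegative, so the numerator may be extended to all outcomes; the
    denominator is at least 1/4. *)
Lemma expected_cost_bound (out : outcome -> solution n m) :
  (forall w, 0 < prob GKR w -> success sel w -> returns sel w (out w)) ->
  expected_cost GKR sel out <=
  4 * (last.+1%:R * (budget * \sum_i \sum_(t <- ts) fcost I i * ly s i t) +
    4 * (\sum_j Cstar I eps k s j) + overhead * ((2 + eps) * (74 * \sum_j Lstar eps k s j))).
Proof.
move=> hout; have b0 := budget_ge0.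
have ps := success_bound; have e0 := eps_gt0.
set A := _ * _ + _; have := overhead_ge0; set B := 2 * _ => B0.
have A0 : 0 <= A.
  apply: addr_ge0; apply: mulr_ge0 => //.
    apply: mulr_ge0 => //; apply: sumr_ge0 => i _; rewrite big_seq; apply: sumr_ge0 => t tts.
    by rewrite mulr_ge0 ?fcost_ge0 // (lp_y_ge0 hs).
  by apply: sumr_ge0 => j _; exact: (Cstar_ge0 hs).
pose Y (w : outcome) := \sum_j \sum_(l : phase) (ptime l)%:R * ((missed j l w)%:R : R).
have Y0 w : 0 <= Y w.
  by apply: sumr_ge0 => j _; apply: sumr_ge0 => l _; rewrite mulr_ge0.
have EY : \sum_(w : outcome) prob GKR w * Y w <= (2 + eps) * (74 * \sum_j Lstar eps k s j).
  apply: le_trans sum_wait; rewrite le_eqVlt; apply/orP; left; apply/eqP.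
  under eq_bigr do rewrite mulr_sumr.
  by rewrite exchange_big; apply: eq_bigr => j _; exact: sum_missed.
rewrite /expected_cost ler_pdivrMr; last by lra.
apply: (@le_trans _ _ (A + B * ((2 + eps) * (74 * \sum_j Lstar eps k s j)))).
  apply: (@le_trans _ _ (\sum_(w : outcome) prob GKR w * (A + B * Y w))).
    rewrite big_mkcond; apply: ler_sum => w _.
    have p0 := prob_ge0 w; have AY : 0 <= A + B * Y w by rewrite addr_ge0 // mulr_ge0.
    case: ifP => [ok|_]; last by rewrite mulr_ge0.
    (* [out] is unconstrained on outcomes of probability zero. *)
    have [->|pn] := eqVneq (prob GKR w) 0; first by rewrite !mul0r.
    apply: ler_wpM2l => //; apply: cost_wait => //; apply: hout => //.
    by rewrite lt_def pn.
  under eq_bigr do rewrite mulrDr mulrCA.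
  rewrite big_split /= -mulr_suml prob_total mul1r lerD2l -mulr_sumr.
  exact: ler_wpM2l.
set Z := A + _; have Z0 : 0 <= Z.
  apply: addr_ge0 => //; apply: (mulr_ge0 B0); apply: mulr_ge0; first by lra.
  apply: mulr_ge0 => //.
  by apply: sumr_ge0 => j _; apply: le_trans ler01 (Lstar_ge1 eps_gt0 hs j).
by move: (Z) Z0 => z z0; have := ler_wpM2l z0 ps; lra.
Qed.

End Run.

Theorem theorem2p8 (R : realType) (K0 : R) :
  exists (K : R) (c : nat), (0 < c)%N /\ forall eps0 : R, exists C : R,
  forall (TE : embedding_algorithm R) (GKR : gkr_algorithm R)
    (hTE : tree_embedding_guarantee K0 TE) (hGKR : gkr_guarantee GKR)
    (n m : nat) (hn : (1 < n)%N) (hm : (1 < m)%N) (I : instance R n m)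
    (T : nat) (hT : (T <= minn n m * dmax (dist I))%N) (hTact : activation_bound I T)
    (opt : lpsol R n m) (hopt : lp_optimal I (iota 1 T) opt)
    (eps : R) (heps : 0 < eps <= eps0)
    (k : nat) (hk : is_TS_bound eps (minn n m * dmax (dist I)) k)
    (s : lpsol R n m) (hs : lp_optimal I (TS eps k) s)
    (sel : selection_rule I eps k s) (hsel : valid_rule sel)
    (out : outcome TE I eps k s -> solution n m)
    (hout : forall w, 0 < prob GKR w -> success sel w -> returns sel w (out w)),
    [/\ prob_failure TE GKR sel <= K / m%:R ^+ c,
        0 < prob_success TE GKR sel,
        forall w, 0 < prob GKR w -> success sel w -> feasible (out w) &
        expected_cost GKR sel out <=
          C * (log2 n%:R * Num.max (log2 n%:R) (log2 m%:R)) * (1 + eps) *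
          lp_obj I (iota 1 T) opt].
Proof.
exists (3 / 2), 1%N; split => // eps0.
(* The constant of [cost_constants] with b = 40 * 192 and E = |eps0|; the absolute value keeps it
   nonnegative for every [eps0]. *)
exists (4 * (40 * 192 * (24 + 148 * `|K0| * (2 + `|eps0|)))).
move=> TE GKR hTE hGKR n m hn hm I T hT hTact opt hopt eps /andP[e0 ee] k hk s hs sel hsel out hout.
have [fs _] := hs; split.
- exact: (failure_bound hTE hGKR hn hm e0 fs hsel).
- apply: lt_le_trans (success_bound hTE hGKR hn hm e0 fs hsel).
  by rewrite invr_gt0.
- by move=> w pw ok; exact: returns_feasible (hout w pw ok).
have hL : lp_obj I (TS eps k) s <= (1 + eps) * lp_obj I (iota 1 T) opt.
  apply: restricted_lp_obj (ltnW hm) e0 _ (proj1 hopt) hs.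
  exact: leq_trans hT (proj1 hk).
apply: le_trans (expected_cost_bound hTE hGKR hn hm e0 fs hsel hout) _.
have [uN N1] := @num_trees_bounds R m hm.
have hph := num_phases hm e0 fs.
have u1 : 1 <= log2 (m%:R : R) := log2_ge1 R hm.
have l1 : 1 <= log2 (n%:R : R) := log2_ge1 R hn.
have mL : log2 n%:R <= Num.max (log2 n%:R) (log2 m%:R) :> R by rewrite le_max lexx.
have mu : log2 m%:R <= Num.max (log2 n%:R) (log2 m%:R) :> R by rewrite le_max lexx orbT.
(* 12 N < 12 (u + 1) <= 24 u, where u = log m >= 1. *)
have pu : (last_phase I eps k s).+1%:R <= 24 * log2 m%:R :> R by move: hph; lra.
have eE : 0 <= eps <= `|eps0| by rewrite ltW //= (le_trans ee) ?ler_norm.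
have F0 : 0 <= \sum_i \sum_(t <- TS eps k) fcost I i * ly s i t.
  apply: sumr_ge0 => i _; rewrite big_seq; apply: sumr_ge0 => t tts.
  by rewrite mulr_ge0 ?fcost_ge0 // (lp_y_ge0 fs).
have C0 : 0 <= \sum_j Cstar I eps k s j by apply: sumr_ge0 => j _; exact: (Cstar_ge0 fs).
have S0 : 0 <= \sum_j Lstar eps k s j.
  by apply: sumr_ge0 => j _; apply: le_trans ler01 (Lstar_ge1 e0 fs j).
have b1 : 1 <= 40 * 192 :> R by lra.
rewrite [40 * (192 * _)]mulrA.
apply: le_trans (cost_constants b1 l1 u1 mL mu pu (normr_ge0 K0) eE F0 C0 S0) _.
rewrite -lp_objE -[leRHS]mulrA; apply: ler_wpM2l hL.
apply: mulr_ge0; first by rewrite !mulr_ge0 // addr_ge0 // !mulr_ge0 // addr_ge0.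
by apply: mulr_ge0; [exact: le_trans ler01 l1|exact: le_trans (le_trans ler01 l1) mL].
Qed.
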